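(* Let $\phi(\xi_1,\xi_2,\xi_3)=\xi_1^2+\xi_2^2-\xi_3^2$. Fix $0<\epsilon<\frac1{1000}$ and a constant $A>0$. Then the following statement is false: there is a constant $C_\epsilon$ such that for every $0<\delta\le1/2$ there exists a collection $\mathcal{S}_\delta$ of rectangular boxes $S\subset[0,1]^3$ such that (1) $\sum_{S\in\mathcal{S}_\delta}\chi_S\le C_\epsilon\log(\delta^{-1})$; (2) every $S\in\mathcal{S}_\delta$ is $(\phi,A\delta)$-flat (and of the form of a parallelepiped); (3) for all $f:\mathbb{R}^4\to\mathbb{C}$ whose Fourier support is in $N_\delta(\mathcal{M}_\phi)$, $$\|f\|_{L^{10/3}}\le C_\epsilon\,\delta^{-\epsilon}\Big(\sum_{S\in\mathcal{S}_\delta}\|f_S\|_{L^{10/3}}^2\Big)^{1/2}.$$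
   Context: $\mathcal{M}_\phi:=\{(\xi,\phi(\xi)):\xi\in[0,1]^3\}\subset\mathbb{R}^4$ and $N_\delta(\mathcal{M}_\phi)$ is its $\delta$-neighborhood in $\mathbb{R}^4$. $\chi_S$ is the indicator function of $S$. A set $S\subset[0,1]^3$ is $(\phi,\delta)$-flat if $\sup_{u,v\in S}|\phi(u)-\phi(v)-\nabla\phi(u)\cdot(u-v)|\le\delta$. For each rectangular box $S\subset\mathbb{R}^3$ a smooth function $\Xi_S$ on $\mathbb{R}^3$ is fixed such that (i) $\widehat{\Xi_S}$ is supported in $2S$ (dilate by factor $2$ about the center); (ii) $0\le\widehat{\Xi_S}\le1$; (iii) $\widehat{\Xi_S}>1/10$ on $S$; (iv) $\|\Xi_S\|_{L^1}\le1000$. Then $f_S(x',x_4):=\int_{\mathbb{R}^3}f(x'-y,x_4)\,\Xi_S(y)\,dy$ for $x'\in\mathbb{R}^3$, $x_4\in\mathbb{R}$. *)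

(* Defs.v *)
From HB Require Import structures.
From mathcomp Require Import all_boot all_order all_algebra.
From mathcomp Require Import complex.
From mathcomp Require Import all_classical all_reals all_analysis.

Set Implicit Arguments.
Unset Strict Implicit.
Unset Printing Implicit Defensive.

Import Order.TTheory GRing.Theory Num.Theory.
Import numFieldNormedType.Exports.

Local Open Scope classical_set_scope.
Local Open Scope complex_scope.
Local Open Scope ring_scope.

(* [R4 R] is convertible to [(R3 R * R)%type]: the splitting x = (x', x_4) is
   the pair (x.1, x.2). *)
Notation R3 R := (R * R * R)%type.
Notation R4 R := (R * R * R * R)%type.

Section Euclidean.
Context {R : realType}.

(* [measurableTypeR R] is [R] with its Borel sigma-algebra, the type on which
   the library's Lebesgue measure lives. *)
Local Notation mR := (measurableTypeR R).

Definition leb3 : {measure set (mR * mR * mR) -> \bar R} :=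
  (@lebesgue_measure R \x @lebesgue_measure R \x @lebesgue_measure R)%E.

Definition leb4 : {measure set (mR * mR * mR * mR) -> \bar R} :=
  (@lebesgue_measure R \x @lebesgue_measure R \x @lebesgue_measure R
     \x @lebesgue_measure R)%E.

Definition dot3 (x y : R3 R) : R :=
  x.1.1 * y.1.1 + x.1.2 * y.1.2 + x.2 * y.2.

Definition dot4 (x y : R4 R) : R := dot3 x.1 y.1 + x.2 * y.2.

(* The library norm on a product type is the sup norm; neighborhoods are taken
   for the Euclidean one. *)
Definition norm4 (x : R4 R) : R := Num.sqrt (dot4 x x).

Definition unit_cube3 : set (R3 R) :=
  [set x | [/\ 0 <= x.1.1 <= 1, 0 <= x.1.2 <= 1 & 0 <= x.2 <= 1]].

Definition gradient3 (phi : R3 R -> R) (u : R3 R) : R3 R :=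
  ('D_(1, 0, 0) phi u, 'D_(0, 1, 0) phi u, 'D_(0, 0, 1) phi u).

Fixpoint C_n (n : nat) (g : R3 R -> R) : Prop :=
  continuous g /\
  if n is m.+1 then
    forall v, (forall x, derivable g x v) /\ C_n m (fun x => 'D_v g x)
  else True.

Definition smooth (f : R3 R -> R[i]) : Prop :=
  forall n, C_n n (fun x => complex.Re (f x)) /\
            C_n n (fun x => complex.Im (f x)).

End Euclidean.

Section ComplexIntegration.
Context {R : realType} {d : measure_display} {T : measurableType d}.
Variable mu : {measure set T -> \bar R}.
Implicit Type f : T -> R[i].

Definition cintegrable f : Prop :=
  mu.-integrable setT (fun x => (complex.Re (f x))%:E) /\
  mu.-integrable setT (fun x => (complex.Im (f x))%:E).

Definition cintegral f : R[i] :=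
  (\int[mu]_x complex.Re (f x)) +i* (\int[mu]_x complex.Im (f x)).

Definition cLnorm (p : R) f : \bar R :=
  Lnorm mu p%:E (fun x => (Normc.normc (f x))%:E).

End ComplexIntegration.

Section Fourier.
Context {R : realType}.

Definition expi (t : R) : R[i] := cos t +i* sin t.

Definition fourier3 (f : R3 R -> R[i]) (xi : R3 R) : R[i] :=
  cintegral leb3 (fun x => f x * expi (- (2 * pi * dot3 x xi))).

Definition fourier4 (f : R4 R -> R[i]) (xi : R4 R) : R[i] :=
  cintegral leb4 (fun x => f x * expi (- (2 * pi * dot4 x xi))).

Definition fun_support {T : topologicalType} (F : T -> R[i]) : set T :=
  closure [set xi | F xi != 0].

End Fourier.

Section Boxes.
Context {R : realType}.

Definition orthonormal3 (u : 'I_3 -> R3 R) : Prop :=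
  forall i j, dot3 (u i) (u j) = (i == j)%:R.

(* Center c, axes u, half side lengths l. *)
Definition box (c : R3 R) (u : 'I_3 -> R3 R) (l : 'I_3 -> R) : set (R3 R) :=
  [set c + \sum_(i < 3) t i *: u i |
     t in [set t : 'I_3 -> R | forall i, `|t i| <= l i]].

(* Boxes have arbitrary orientation and positive side lengths. For a degenerate
   box no function could satisfy [box_multiplier] below, since its continuous
   Fourier transform would be supported in a null set. *)
Definition rectangular_box (S : set (R3 R)) : Prop :=
  exists c u l, [/\ orthonormal3 u, forall i, 0 < l i & S = box c u l].

(* In the order of [R[i]], an inequality with a real number on one side also
   says that the other side is real. *)
Definition box_multiplier (S twoS : set (R3 R)) (X : R3 R -> R[i]) : Prop :=
  smooth X /\
  [/\ fun_support (fourier3 X) `<=` twoS,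
      forall xi, 0 <= fourier3 X xi <= 1,
      forall xi, S xi -> 1 / 10 < fourier3 X xi &
      cintegrable leb3 X /\ (cLnorm leb3 1 X <= 1000%:E)%E].

(* The dilate of S = box c u l by the factor 2 about its center is
   box c u (2 l). The function Xi S depends on the set S only, not on the
   choice of c, u, l. *)
Definition box_multiplier_family (Xi : set (R3 R) -> R3 R -> R[i]) : Prop :=
  forall c u l, orthonormal3 u -> (forall i, 0 < l i) ->
    box_multiplier (box c u l) (box c u (fun i => 2 * l i)) (Xi (box c u l)).

Definition box_part (Xi : set (R3 R) -> R3 R -> R[i]) (f : R4 R -> R[i])
    (S : set (R3 R)) (x : R4 R) : R[i] :=
  cintegral leb3 (fun y => f (x.1 - y, x.2) * Xi S y).

End Boxes.

Section Graphs.
Context {R : realType}.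
Implicit Type phi : R3 R -> R.

Definition graph_surface phi : set (R4 R) :=
  [set (xi, phi xi) | xi in unit_cube3].

Definition neighborhood (delta : R) (M : set (R4 R)) : set (R4 R) :=
  [set x | exists2 m, M m & norm4 (x - m) < delta].

Definition flat phi (delta : R) (S : set (R3 R)) : Prop :=
  (ereal_sup [set (`|phi u - phi v - dot3 (gradient3 phi u) (u - v)|)%:E
               | u in S & v in S] <= delta%:E)%E.

Definition hyperbolic_form (xi : R3 R) : R :=
  xi.1.1 ^+ 2 + xi.1.2 ^+ 2 - xi.2 ^+ 2.

End Graphs.

(* Main.v *)
Require Import Defs.
From HB Require Import structures.
From mathcomp Require Import all_boot all_order all_algebra finmap.
From mathcomp Require Import complex.
From mathcomp Require Import all_classical all_reals all_analysis.
From mathcomp Require Import measurable_realfun.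
From mathcomp Require Import ring lra.

(** Write Q for the form x1^2 + x2^2 - x3^2, which is the phase itself. The idea
is that the surface is ruled. If n is a null vector of Q, then Q is affine on
every line of direction n, so the graph contains a segment of unit size above
each such line. The null directions (a, sqrt (1 - a^2), 1), with a between 0 and
1, form a continuum, but a flat box can contain a long segment of essentially
only one of them. Covering all of them at every point of the cube therefore
takes more boxes than a logarithmic overlap provides.

The test functions are wave packets. For a base point xi0, a null direction n
and r = 1/8, eta = delta/8, the packet f has its Fourier transform supported
over the tube of the points xi0 + (eta p, eta q, 0) + r s n with |p|, |q|, |s|
<= 1, at vertical distance at most eta from the tangent plane at xi0. As Q
vanishes at n, this region lies in the delta-neighborhood of the surface
(packet_region_sub). The modulus of f is a product of Fejer kernels composed
with an affine map, so the integrals of |f| and of |f|^p are the same multiple,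
the Jacobian packet_scale, of constants which depend on p only
(integral_packet_powR).

For a box S, let M be the Lebesgue measure of the set of those (p, q, s) for
which the frequency lies in 2S (trace_mass). Expanding the Fejer kernel of f as
a superposition of characters shows that f_S collects only the frequencies in
2S, whence |f_S| <= 2M pointwise (normc_box_part_le). Interpolating this bound
with the convolution bound for the integral of |f_S| gives ||f_S||_p^p <= const
M^(p-1) ||f||_1 (box_part_Lp). With p = 10/3 the decoupling inequality for f,
squared, becomes a lower bound which does not depend on the packet, const / C^2
<= sum over S of (2M)^(7/5), where C stands for the whole constant in that
inequality (packet_decoupling).

The mean of M over the base point xi0 is, by Tonelli, at most a constant times
the volume of S (integral_leb3_trace), and by the bound on the overlap the
volumes add up to at most L, a multiple of log (1/delta). As M^(7/5) = M
M^(2/5), a box whose traces have measure at most of order lambda enters with a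
factor lambda^(2/5), any other box with a factor of order 1
(average_over_tubes). A box with a larger trace contains two points of a tube at
distance of order lambda along n. If this happens for two null directions n, n'
with parameters a, a', polarizing the estimate |Q| <= A delta on S - S gives
lambda^2 (a - a')^2 <= const lambda^2 |B(n, n')| <= const delta
(straddles_uniq), where B is the bilinear form of Q. So among N directions with
spacing 1/N, where lambda / N is much larger than delta^(1/2), at most one is
exceptional for a given box.

Summing over the N directions yields N / C^2 <= const (1 + N lambda^(2/5)) L
(fixed_scale). Both C^2 and L grow at most like small powers of 1/delta, so the
choice N = M^3, lambda = M^-10, delta = M^-30 with a large integer M contradicts
this (exists_bad_scale). *)

Set Implicit Arguments.
Unset Strict Implicit.
Unset Printing Implicit Defensive.

Import Order.TTheory GRing.Theory Num.Theory.
Import numFieldNormedType.Exports.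

Local Open Scope classical_set_scope.
Local Open Scope complex_scope.
Local Open Scope ring_scope.

(** * Maps that multiply a measure by a constant *)

Section Scales.
Context {R : realType} {d : measure_display} {T : measurableType d}.
Variable mu : {measure set T -> \bar R}.

(** A change of variables with constant Jacobian 1 / k. The linear maps of this
proof are composed of shears and dilations of single coordinates, so the value
of k is obtained by composition instead of from a determinant. *)
Definition scales (k : R) (phi : T -> T) : Prop :=
  [/\ 0 < k, measurable_fun [set: T] phi &
      forall A, measurable A -> mu (phi @^-1` A) = (k%:E * mu A)%E].

Lemma scales_comp k l phi psi :
  scales k phi -> scales l psi -> scales (k * l) (psi \o phi).
Proof.
move=> [k0 mphi Hphi] [l0 mpsi Hpsi]; split; first exact: mulr_gt0.
  exact: measurableT_comp.
move=> A mA; rewrite comp_preimage Hphi; last first.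
  by rewrite -[X in measurable X]setTI; exact: mpsi.
by rewrite Hpsi// muleA EFinM.
Qed.

Lemma scales_ge0_integral k phi (f : T -> \bar R) :
  scales k phi -> measurable_fun [set: T] f -> (forall x, 0 <= f x)%E ->
  (\int[mu]_x f (phi x) = k%:E * \int[mu]_x f x)%E.
Proof.
move=> [k0 mphi H] mf f0.
have := @ge0_integral_pushforward _ _ T T R phi mphi mu setT f measurableT mf.
rewrite preimage_setT => <- //.
rewrite -(ge0_integral_mscale mu measurableT (NngNum (ltW k0)))//.
by apply: eq_measure_integral => A mA _; exact: H.
Qed.

Lemma scales_integral k phi (f : T -> \bar R) :
  scales k phi -> mu.-integrable setT f ->
  (\int[mu]_x f (phi x) = k%:E * \int[mu]_x f x)%E.
Proof.
move=> sc fi; have mf := measurable_int _ fi.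
rewrite -[LHS]/(\int[mu]_x (f \o phi) x)%E integralE [in RHS]integralE.
under eq_integral do rewrite funepos_comp/=.
under [X in (_ - X)%E = _]eq_integral do rewrite funeneg_comp/=.
rewrite !(scales_ge0_integral sc)//.
- apply/esym/muleBr => //; apply: fin_num_adde_defl.
  by rewrite fin_numN integrable_neg_fin_num.
- exact: measurable_funeneg.
- exact: measurable_funepos.
Qed.

Lemma scales_integrable k phi (f : T -> \bar R) :
  scales k phi -> mu.-integrable setT f ->
  mu.-integrable setT (f \o phi).
Proof.
move=> sc /integrableP[mf fi]; have [k0 mphi _] := sc.
apply/integrableP; split; first exact: measurableT_comp.
rewrite (scales_ge0_integral sc (f := fun x => `|f x|%E))//.
  by rewrite lte_mul_pinfty// lee_fin ltW.
exact: measurableT_comp.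
Qed.

End Scales.

Section ScalesProd.
Context {R : realType} {d1 d2 : measure_display}.
Context {X : measurableType d1} {Y : measurableType d2}.
Variable mu : {sigma_finite_measure set X -> \bar R}.
Variable nu : {sigma_finite_measure set Y -> \bar R}.

(** A map that acts on each vertical fiber as a change of variables of constant
Jacobian, possibly a different one on each fiber: this covers shears. *)
Lemma scales_skewr k (U : X * Y -> Y) :
  0 < k -> measurable_fun [set: X * Y] U -> (forall x, scales nu k (fun y => U (x, y))) ->
  scales (mu \x nu)%E k (fun z => (z.1, U z)).
Proof.
move=> k0 mU sU; split=> //; first exact: measurable_fun_pair.
move=> A mA; rewrite /product_measure1 -ge0_integralZl//.
- apply: eq_integral => x _ /=; have [_ _ <-] := sU x; last exact: measurable_xsection.
  by congr (nu _); apply/seteqP; split=> y; rewrite /xsection/= !inE.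
- exact: measurable_fun_xsection.
- by rewrite lee_fin ltW.
Qed.

Lemma prod_measure_ysection (A : set (X * Y)) : measurable A ->
  ((mu \x nu) A = \int[nu]_y mu (ysection A y))%E.
Proof.
move=> mA; apply: (product_measure_unique (m' := (mu \x^ nu)%E)) => //.
by move=> B C mB mC /=; rewrite product_measure2E.
Qed.

Lemma scales_skewl k (U : X * Y -> X) :
  0 < k -> measurable_fun [set: X * Y] U -> (forall y, scales mu k (fun x => U (x, y))) ->
  scales (mu \x nu)%E k (fun z => (U z, z.2)).
Proof.
move=> k0 mU sU; have mUz : measurable_fun setT (fun z : X * Y => (U z, z.2)).
  exact: measurable_fun_pair.
split=> // A mA; rewrite /= !prod_measure_ysection//; last first.
  by rewrite -[X in measurable X]setTI; exact: mUz.
rewrite -ge0_integralZl//.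
- apply: eq_integral => x _ /=; have [_ _ <-] := sU x; last exact: measurable_ysection.
  by congr (mu _); apply/seteqP; split=> y; rewrite /ysection/= !inE.
- exact: measurable_fun_ysection.
- by rewrite lee_fin ltW.
Qed.

Lemma scales_prod k l phi psi : scales mu k phi -> scales nu l psi ->
  scales (mu \x nu)%E (k * l) (fun z => (phi z.1, psi z.2)).
Proof.
move=> sphi spsi; have [k0 mphi _] := sphi; have [l0 mpsi _] := spsi.
apply: (scales_comp (phi := fun z => (phi z.1, z.2)) (psi := fun z => (z.1, psi z.2))).
  by apply: (@scales_skewl k (fun z => phi z.1)) => //; exact: measurableT_comp.
by apply: (@scales_skewr l (fun z => psi z.2)) => //; exact: measurableT_comp.
Qed.

End ScalesProd.

Section AffineLine.
Context {R : realType}.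
Local Notation leb := (@lebesgue_measure R).
Local Notation mR := (measurableTypeR R).

Lemma measurable_affine (a b : R) : measurable_fun setT (fun t : mR => a * t + b : mR).
Proof. by apply: measurable_funD => //; exact: measurable_funM. Qed.

Lemma scales_affine (a b : R) : a != 0 ->
  scales leb `|a|^-1 (fun t : mR => a * t + b : mR).
Proof.
move=> a0; have k0 : 0 < `|a| by rewrite normr_gt0.
split; [by rewrite invr_gt0|exact: measurable_affine|move=> A mA].
pose phi : mR -> mR := fun t => a * t + b.
have mphi : measurable_fun setT phi by exact: measurable_affine.
(* Uniqueness of Lebesgue measure: it is enough to compare both sides on half-open
   intervals, where the preimage is explicit. *)
suff H : forall B, measurable B ->
    leb B = mscale (NngNum (ltW k0)) (pushforward leb phi) B.
  rewrite [X in _ = (_ * X)%E](H mphi A mA) /mscale/= muleA -EFinM mulVf ?lt0r_neq0// mul1e//.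
move=> ?; apply: lebesgue_measure_unique => // X [[x y] /= xy <-].
rewrite /mscale/= /pushforward.
have [{}a0|{}a0] : 0 < a \/ a < 0 by lra.
  have -> : phi @^-1` `]x, y]%classic = `](x - b) / a, (y - b) / a]%classic.
    by apply/seteqP; split=> t; rewrite /phi/= !in_itv/= ltr_pdivrMr// ler_pdivlMr//;
      rewrite [t * a]mulrC ltrBlDr lerBrDr.
  rewrite !lebesgue_measure_itv/= !lte_fin ltr_pM2r ?invr_gt0// ltrD2r.
  case: ifPn => _; last by rewrite mule0.
  by rewrite -!EFinD -EFinM gtr0_norm//; congr (_%:E); field; rewrite lt0r_neq0.
have -> : phi @^-1` `]x, y]%classic = `[(y - b) / a, (x - b) / a[%classic.
  by apply/seteqP; split=> t; rewrite /phi/= !in_itv/= ler_ndivrMr// ltr_ndivlMr//;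
      rewrite [t * a]mulrC ltrBlDr lerBrDr andbC.
rewrite !lebesgue_measure_itv/= !lte_fin ltr_nM2r ?invr_lt0// ltrD2r.
case: ifPn => _; last by rewrite mule0.
by rewrite -!EFinD -EFinM ltr0_norm//; congr (_%:E); field; rewrite ltr0_neq0.
Qed.

Lemma scales_translation (b : R) : scales leb 1 (fun t : mR => t + b : mR).
Proof.
have := scales_affine b (oner_neq0 R); rewrite normr1 invr1.
by congr scales; apply/funext => t; rewrite mul1r.
Qed.

End AffineLine.

(** * The Fejer kernel and the triangle function *)

Section Fejer.
Context {R : realType}.
Local Notation leb := (@lebesgue_measure R).
Local Notation mR := (measurableTypeR R).

Definition tri (x : R) : R := Num.max 0 (1 - `|x|).

(** The square of sin (pi t) / (pi t), written with the double angle. *)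
Definition fejer (t : R) : R :=
  if t == 0 then 1 else (1 - cos (2 * pi * t)) / (2 * pi ^+ 2 * t ^+ 2).

Lemma tri_ge0 x : 0 <= tri x. Proof. by rewrite le_max lexx. Qed.

Lemma tri_le1 x : tri x <= 1.
Proof. by rewrite ge_max ler01 gerBl normr_ge0. Qed.

Lemma triN x : tri (- x) = tri x. Proof. by rewrite /tri normrN. Qed.

Lemma tri_eq0 x : x \notin `[(-1)%R, 1%R] -> tri x = 0.
Proof.
rewrite in_itv/= -ler_norml -ltNge => x1; apply/max_idPl.
by rewrite subr_le0 ltW.
Qed.

Lemma continuous_tri : continuous tri.
Proof.
move=> x; have -> : tri = (cst 0 \max (fun y => 1 - `|y|)) by [].
apply: continuous_max; first exact: cvg_cst.
by apply: cvgB; [exact: cvg_cst|exact: norm_continuous].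
Qed.

Lemma fejerM t : 2 * pi ^+ 2 * t ^+ 2 * fejer t = 1 - cos (2 * pi * t).
Proof.
rewrite /fejer; have [->|t0] := eqVneq t 0.
  by rewrite !mulr0 cos0 expr0n mulr0 mul0r subrr.
have p0 : pi != 0 :> R by rewrite lt0r_neq0 ?pi_gt0.
move: (@pi R) p0 => p p0; field.
by rewrite t0 p0.
Qed.

Lemma integral_odd (f : mR -> R) :
  (forall x, f (- x) = - f x) -> leb.-integrable setT (EFin \o f) ->
  (\int[leb]_x (f x)%:E = 0)%E.
Proof.
move=> fN fi; have N10 : -1 != 0 :> R by rewrite oppr_eq0 oner_neq0.
have := scales_integral (scales_affine 0 N10) fi.
rewrite normrN normr1 invr1 mul1e /=.
under eq_integral do rewrite mulN1r addr0 fN EFinN.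
rewrite integralN/=; last first.
  by apply: fin_num_adde_defl; rewrite fin_numN (integrable_neg_fin_num _ fi).
have := integrable_fin_num measurableT fi => /=.
by case: (integral _ _ _) => //= r _ [] ?; congr EFin; lra.
Qed.

Lemma derive_FTC (a b : R) (f F : R -> R) : a < b -> continuous f ->
  (forall x, is_derive (x : R) (1 : R) F (f x)) ->
  (\int[leb]_(x in `[a, b]) (f x)%:E = (F b - F a)%:E)%E.
Proof.
move=> ab cf dF; rewrite (continuous_FTC2 (F := F) ab) ?EFinB//.
- exact: continuous_subspaceT.
- have cF x : {for x, continuous F}.
    by apply/differentiable_continuous/derivable1_diffP; case: (dF x).
  split.
  + by move=> x _; case: (dF x).
  + exact: cvg_at_right_filter (cF a).
  + exact: cvg_at_left_filter (cF b).
- by move=> x _; rewrite derive1E; exact: derive_val.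
Qed.

Lemma continuous_lin_cos c b : continuous (fun x : R => (1 + c * x) * cos (b * x)).
Proof.
move=> x; apply: cvgM.
  by apply: cvgD; [exact: cvg_cst|apply: cvgM; [exact: cvg_cst|exact: cvg_id]].
apply: continuous_comp; last exact: continuous_cos.
by apply: cvgM; [exact: cvg_cst|exact: cvg_id].
Qed.

Lemma integral_lin_cos (c b u v : R) : u < v -> b != 0 ->
  (\int[leb]_(x in `[u, v]) ((1 + c * x) * cos (b * x))%:E =
   (((1 + c * v) * sin (b * v) / b + c * cos (b * v) / b ^+ 2) -
    ((1 + c * u) * sin (b * u) / b + c * cos (b * u) / b ^+ 2))%:E)%E.
Proof.
move=> uv b0.
apply: (@derive_FTC u v _ (fun x => (1 + c * x) * sin (b * x) / b + c * cos (b * x) / b ^+ 2)) => //.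
  exact: continuous_lin_cos.
move=> x; apply: is_derive_eq.
rewrite /GRing.scale/=.
by field.
Qed.

Lemma integrable_tri : leb.-integrable setT (fun x : mR => (tri x)%:E).
Proof.
have -> : (fun x : mR => (tri x)%:E) = (EFin \o tri) \_ `[(-1)%R, 1%R]%classic.
  apply/funext => x; rewrite patchE; case: ifPn => // xn.
  by rewrite tri_eq0//; move: xn; rewrite notin_setE/= => /negP.
apply: (iffLR (integrable_mkcond _ _)); first exact: measurable_itv.
apply: continuous_compact_integrable; first exact: segment_compact.
exact/continuous_subspaceT/continuous_tri.
Qed.

Lemma measurable_cos_lin c : measurable_fun setT (fun x : mR => cos (c * x) : mR).
Proof.
apply: measurableT_comp; first exact: continuous_measurable_fun (@continuous_cos R).
exact: measurable_funM.
Qed.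

Lemma measurable_sin_lin c : measurable_fun setT (fun x : mR => sin (c * x) : mR).
Proof.
apply: measurableT_comp; first exact: continuous_measurable_fun (@continuous_sin R).
exact: measurable_funM.
Qed.

Lemma integrableM_le1 (f g : mR -> mR) :
  leb.-integrable setT (EFin \o f) -> measurable_fun setT g ->
  (forall x, `|g x| <= 1) -> leb.-integrable setT (fun x => (f x * g x)%:E).
Proof.
move=> fi mg g1; apply: (le_integrable measurableT _ _ fi).
  apply/measurable_EFinP; apply: measurable_funM => //.
  by apply/measurable_EFinP; exact: (measurable_int _ fi).
by move=> x _; rewrite lee_fin normrM ler_piMr.
Qed.

Lemma integrable_tri_cos b :
  leb.-integrable setT (fun x : mR => (tri x * cos (b * x))%:E).
Proof.
apply: (integrableM_le1 integrable_tri); first exact: measurable_cos_lin.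
by move=> x; exact: cos_max.
Qed.

Lemma integral_tri_cos_split (b : R) :
  (\int[leb]_x (tri x * cos (b * x))%:E =
   \int[leb]_(x in `[(-1)%R, 0%R]) ((1 + 1 * x) * cos (b * x))%:E +
   \int[leb]_(x in `[0%R, 1%R]) ((1 + (- 1) * x) * cos (b * x))%:E)%E.
Proof.
have mf := measurable_int _ (integrable_tri_cos b).
transitivity (\int[leb]_(x in `[(-1)%R, 1%R]) (tri x * cos (b * x))%:E)%E.
  rewrite [RHS]integral_mkcond; apply: eq_integral => x _.
  rewrite patchE; case: ifPn => // xn.
  by rewrite tri_eq0 ?mul0r//; move: xn; rewrite notin_setE/= => /negP.
have -> : `[(-1)%R, 1%R]%classic = (`[(-1)%R, 0%R] `|` `]0%R, 1%R])%classic :> set R.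
  by rewrite -itv_bndbnd_setU// bnd_simp// lerN10.
rewrite integral_setU//; first last.
- by apply/disj_setPS => x /=; rewrite !in_itv/= => -[/andP[_ x0] /andP[]]; rewrite ltNge x0.
- exact: measurable_funTS mf.
congr (_ + _)%E.
  apply: eq_integral => x; rewrite inE/= in_itv/= => /andP[x1 x0].
  rewrite /tri ler0_norm// opprK mul1r; congr (_ * _)%:E.
  by apply/max_idPr; rewrite -lerBlDl sub0r.
rewrite integral_itv_obnd_cbnd; last exact: measurable_funTS mf.
apply: eq_integral => x; rewrite inE/= in_itv/= => /andP[x0 x1].
rewrite /tri ger0_norm// mulN1r; congr (_ * _)%:E.
by apply/max_idPr; rewrite subr_ge0.
Qed.

Lemma integral_tri : (\int[leb]_x (tri x)%:E = 1)%E.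
Proof.
transitivity (\int[leb]_x (tri x * cos (0 * x))%:E)%E.
  by apply: eq_integral => x _; rewrite mul0r cos0 mulr1.
rewrite integral_tri_cos_split.
under eq_integral do rewrite mul0r cos0 mulr1 mul1r.
under [X in (_ + X)%E]eq_integral do rewrite mul0r cos0 mulr1 mulN1r.
have d1 (x : R) : is_derive x (1 : R) (fun x => x + x ^+ 2 / 2) (1 + x).
  by apply: is_derive_eq; rewrite /GRing.scale/=; field.
have d2 (x : R) : is_derive x (1 : R) (fun x => x - x ^+ 2 / 2) (1 - x).
  by apply: is_derive_eq; rewrite /GRing.scale/=; field.
rewrite (derive_FTC (F := fun x => x + x ^+ 2 / 2)) //; last first.
  by move=> x; apply: cvgD; [exact: cvg_cst|exact: cvg_id].
rewrite (derive_FTC (F := fun x => x - x ^+ 2 / 2)) //.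
- by rewrite -EFinD; congr EFin; field.
- by move=> x; apply: cvgB; [exact: cvg_cst|exact: cvg_id].
Qed.

(** The kernel is the Fourier transform of the triangle function, which exhibits
it as a superposition of frequencies in [-1, 1]. *)
Lemma integral_tri_cos t :
  (\int[leb]_x (tri x * cos (2 * pi * t * x))%:E = (fejer t)%:E)%E.
Proof.
have [->|t0] := eqVneq t 0.
  rewrite /fejer eqxx -[RHS]integral_tri; apply: eq_integral => x _.
  by rewrite mulr0 mul0r cos0 mulr1.
have p0 : pi != 0 :> R by rewrite lt0r_neq0 ?pi_gt0.
have b0 : 2 * pi * t != 0 by rewrite !mulf_neq0.
rewrite integral_tri_cos_split !integral_lin_cos ?ltr01 ?ltrN10//.
rewrite -EFinD; congr EFin.
rewrite /fejer (negbTE t0) !mulr0 !mulr1 !mulrN1 sin0 cos0 cosN.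
move: (@pi R) (cos _) (sin _) (sin _) p0 {b0} => p c s s' p0.
field.
by rewrite t0 p0.
Qed.

Lemma fejer_ge0 t : 0 <= fejer t.
Proof.
rewrite /fejer; case: eqP => // _; rewrite divr_ge0 ?subr_ge0 ?cos_le1//.
by rewrite mulr_ge0 ?sqr_ge0// mulr_ge0// sqr_ge0.
Qed.

Lemma fejer_le1 t : fejer t <= 1.
Proof.
rewrite -lee_fin -integral_tri_cos -integral_tri; apply: le_integral => //.
- exact: integrable_tri_cos.
- exact: integrable_tri.
- by move=> x _; rewrite lee_fin ler_piMr ?tri_ge0 ?cos_le1.
Qed.

Lemma fejer0 : fejer 0 = 1. Proof. by rewrite /fejer eqxx. Qed.

Lemma fejerN t : fejer (- t) = fejer t.
Proof. by rewrite /fejer oppr_eq0 mulrN cosN sqrrN. Qed.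

Lemma measurable_fejer : measurable_fun setT (fejer : mR -> mR).
Proof.
rewrite /fejer; apply: measurable_fun_ifT => //.
  by apply: measurable_fun_eqr.
apply: measurable_funM.
  by apply: measurable_funB => //; exact: measurable_cos_lin.
have -> : (fun t : R => (2 * pi ^+ 2 * t ^+ 2)^-1) =
          (fun t => (2 * pi ^+ 2 * t ^+ 2) `^ (-1)).
  apply/funext => t; rewrite powR_inv1//.
  by rewrite mulr_ge0 ?sqr_ge0// mulr_ge0// sqr_ge0.
apply: (measurableT_comp (measurable_powR _)).
by apply: measurable_funM => //; exact: measurable_funX.
Qed.

Lemma sqr_pi_ge2 : 2 <= pi ^+ 2 :> R.
Proof.
have : 2 <= pi :> R by exact: pi_ge2.
nra.
Qed.

(** An integrable majorant of the kernel. *)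
Lemma fejer_le t : fejer t <= 2 * (oneDsqr t)^-1.
Proof.
have d0 : 0 < oneDsqr t by [].
rewrite ler_pdivlMr// /oneDsqr.
have := fejerM t; have := cos_geN1 (2 * pi * t); have := sqr_pi_ge2.
have := fejer_le1 t; have := fejer_ge0 t.
move: (fejer t) (pi ^+ 2) (cos _) => f p c f0 f1 p2 c1 E.
have : 2 * p * t ^+ 2 * f <= 2 by lra.
have : 0 <= t ^+ 2 * f by rewrite mulr_ge0// sqr_ge0.
move: (t ^+ 2) => s; nra.
Qed.

Lemma integrable_oneDsqrV : leb.-integrable setT (fun x : mR => ((oneDsqr x)^-1)%:E).
Proof.
have mf : measurable_fun setT (fun x : mR => ((oneDsqr x)^-1)%:E).
  apply/measurable_EFinP; apply: continuous_measurable_fun.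
  exact: (@continuous_oneDsqrV R).
apply/integrableP; split => //.
under eq_integral => x _ do rewrite gee0_abs ?lee_fin ?invr_ge0//.
rewrite ge0_symfun_integralT//.
- rewrite -set_itvcy integral0y_oneDsqr -EFinM ltry//.
- exact: continuous_oneDsqrV.
- by move=> x /=; rewrite /oneDsqr sqrrN.
Qed.

Lemma integrable_fejer : leb.-integrable setT (fun x : mR => (fejer x)%:E).
Proof.
apply: le_integrable (integrableZl measurableT 2 integrable_oneDsqrV) => //.
  by apply/measurable_EFinP; exact: measurable_fejer.
move=> x _ /=; rewrite lee_fin !ger0_norm ?fejer_ge0 ?fejer_le//.
Qed.

Definition fejer_mass : R := fine (\int[leb]_x (fejer x)%:E).

Lemma integral_fejer : (\int[leb]_x (fejer x)%:E = fejer_mass%:E)%E.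
Proof. by rewrite fineK//; exact: integrable_fin_num integrable_fejer. Qed.

Lemma integrable_fejer_scale (a : R) : a != 0 ->
  leb.-integrable setT (fun x : mR => (fejer (a * x))%:E).
Proof.
move=> a0; have := scales_integrable (scales_affine 0 a0) integrable_fejer.
by apply: eq_integrable => // x _ /=; rewrite addr0.
Qed.

Lemma integral_fejer_scale (a : R) : a != 0 ->
  (\int[leb]_x (fejer (a * x))%:E = (`|a|^-1 * fejer_mass)%:E)%E.
Proof.
move=> a0; rewrite EFinM -integral_fejer.
rewrite -(scales_integral (scales_affine 0 a0) integrable_fejer).
by apply: eq_integral => x _; rewrite addr0.
Qed.

Lemma integrable_sqr_fejer (a : R) :
  leb.-integrable setT (fun x : mR => (a ^+ 2 * fejer (a * x))%:E).
Proof.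
have [->|a0] := eqVneq a 0.
  by under eq_fun do rewrite expr0n/= mul0r; exact: integrable0.
have := integrableZl measurableT (a ^+ 2) (integrable_fejer_scale a0).
by apply: eq_integrable => // x _ /=; rewrite EFinM.
Qed.

Lemma integral_sqr_fejer (a : R) :
  (\int[leb]_x (a ^+ 2 * fejer (a * x))%:E = (`|a| * fejer_mass)%:E)%E.
Proof.
have [->|a0] := eqVneq a 0.
  rewrite normr0 mul0r; under eq_integral do rewrite expr0n/= mul0r.
  by rewrite integral0.
under eq_integral do rewrite EFinM.
rewrite integralZl//; last exact: integrable_fejer_scale.
rewrite integral_fejer_scale// -EFinM; congr EFin.
rewrite mulrA -real_normK ?num_real//; congr (_ * _).
by field; rewrite normr_eq0.
Qed.

(** Multiplying the identity fejerM by cos (2 pi x t) turns 1 - cos into a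
second difference in x. Hence the left side is a second difference of the
functions a^2 fejer (a t), whose integrals are multiples of |a|. This computes
the Fourier transform of the kernel without Fourier inversion. *)
Lemma fejer_cosE t x : fejer t * cos (2 * pi * x * t) =
  2^-1 * ((x + 1) ^+ 2 * fejer ((x + 1) * t) + (x - 1) ^+ 2 * fejer ((x - 1) * t) -
          2 * (x ^+ 2 * fejer (x * t))).
Proof.
have [->|t0] := eqVneq t 0.
  by rewrite !mulr0 cos0 fejer0; field.
have p0 : pi != 0 :> R by rewrite lt0r_neq0 ?pi_gt0.
have q0 : 2 * pi ^+ 2 * t ^+ 2 != 0 by rewrite !mulf_neq0// expf_neq0.
have H a : 2 * pi ^+ 2 * t ^+ 2 * (a ^+ 2 * fejer (a * t)) = 1 - cos (2 * pi * (a * t)).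
  by rewrite -fejerM; ring.
apply: (mulfI q0); rewrite [LHS]mulrA fejerM.
transitivity (2^-1 * ((1 - cos (2 * pi * ((x + 1) * t))) + (1 - cos (2 * pi * ((x - 1) * t)))
   - 2 * (1 - cos (2 * pi * (x * t))))); last by rewrite -!H; ring.
have -> : 2 * pi * ((x + 1) * t) = 2 * pi * x * t + 2 * pi * t by ring.
have -> : 2 * pi * ((x - 1) * t) = 2 * pi * x * t - 2 * pi * t by ring.
have -> : 2 * pi * (x * t) = 2 * pi * x * t by ring.
by rewrite cosD cosB; field.
Qed.

(** The kernel is band limited: the second difference of the absolute value
vanishes at points of modulus at least 1. *)
Lemma integral_fejer_cos x : 1 <= `|x| ->
  (\int[leb]_t (fejer t * cos (2 * pi * x * t))%:E = 0)%E.
Proof.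
move=> x1.
under eq_integral do rewrite fejer_cosE EFinM EFinB EFinD [X in (_ - X)%E]EFinM.
have i1 := integrable_sqr_fejer (x + 1).
have i2 := integrable_sqr_fejer (x - 1).
have i3 := integrable_sqr_fejer x.
have i12 := integrableD measurableT i1 i2.
have i33 := integrableZl measurableT 2 i3.
rewrite integralZl//; last exact: integrableB.
rewrite integralB// integralD// integralZl// !integral_sqr_fejer.
rewrite -[LHS]/((2^-1 * (`|x + 1| * fejer_mass + `|x - 1| * fejer_mass -
  2 * (`|x| * fejer_mass)))%:E); congr EFin.
(* The integral of a^2 fejer (a t) is |a| times that of fejer. *)
suff E : `|x + 1| + `|x - 1| = 2 * `|x| by nra.
move: x1; rewrite ler_normr => /orP[x1|x1].
  by rewrite !ger0_norm; lra.
by rewrite !ler0_norm; lra.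
Qed.

Lemma integral_fejer_sin x :
  (\int[leb]_t (fejer t * sin (2 * pi * x * t))%:E = 0)%E.
Proof.
apply: integral_odd; first by move=> t; rewrite fejerN mulrN sinN mulrN.
apply: (integrableM_le1 integrable_fejer); first exact: measurable_sin_lin.
by move=> t; exact: sin_max.
Qed.

(** For t between 1/4 and 1/2 the cosine in the kernel is nonpositive. *)
Lemma fejer_lower t : 4^-1 <= t <= 2^-1 -> 2 / pi ^+ 2 <= fejer t.
Proof.
move=> /andP[t1 t2]; have p0 : 0 < pi :> R by exact: pi_gt0.
have c0 : cos (2 * pi * t) <= 0.
  rewrite -oppr_ge0 -cosDpi cosDpi oppr_ge0 -[leLHS]opprK -cosDpi oppr_le0.
  have -> : cos (2 * pi * t + pi) = cos (2 * pi * t - pi).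
    by rewrite -[RHS]cosD2pi; congr cos; ring.
  by apply: cos_ge0_pihalf; apply/andP; split; nra.
have t0 : 0 < t by lra.
have d0 : 0 < 2 * pi ^+ 2 * t ^+ 2 by rewrite !mulr_gt0// exprn_gt0.
have -> : fejer t = (1 - cos (2 * pi * t)) / (2 * pi ^+ 2 * t ^+ 2).
  by rewrite -fejerM mulrC mulKf// lt0r_neq0.
rewrite ler_pdivlMr// (@le_trans _ _ 1)//; last by lra.
have -> : 2 / pi ^+ 2 * (2 * pi ^+ 2 * t ^+ 2) = 4 * t ^+ 2.
  by move: (@pi R) p0 {c0 d0} => p p0; field; rewrite lt0r_neq0.
nra.
Qed.

Lemma integrable_fejer_powR (p : R) : 1 <= p ->
  leb.-integrable setT (fun x : mR => (fejer x `^ p)%:E).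
Proof.
move=> p1; apply: le_integrable integrable_fejer => //.
  by apply/measurable_EFinP; apply: (measurableT_comp (measurable_powR _)) measurable_fejer.
move=> x _ /=; rewrite lee_fin !ger0_norm ?fejer_ge0 ?powR_ge0//.
have [->|f0] := eqVneq (fejer x) 0; first by rewrite powR0 ?lt0r_neq0//; lra.
by rewrite -[leRHS]powRr1 ?fejer_ge0// ger_powR// lt_neqAle eq_sym f0 fejer_ge0 fejer_le1.
Qed.

Definition fejer_pmass (p : R) : R := fine (\int[leb]_x (fejer x `^ p)%:E).

Lemma integral_fejer_powR p : 1 <= p ->
  (\int[leb]_x (fejer x `^ p)%:E = (fejer_pmass p)%:E)%E.
Proof.
by move=> p1; rewrite fineK//; exact: integrable_fin_num (integrable_fejer_powR p1).
Qed.

(** The kernel is bounded below on the interval from 1/4 to 1/2. *)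
Lemma fejer_pmass_gt0 p : 1 <= p -> 0 < fejer_pmass p.
Proof.
move=> p1; rewrite -lte_fin -integral_fejer_powR//.
have c0 : 0 < 2 / pi ^+ 2 :> R by rewrite divr_gt0// exprn_gt0// pi_gt0.
have mf : measurable_fun setT (fun x : mR => (fejer x `^ p)%:E).
  exact: measurable_int (integrable_fejer_powR p1).
apply: (@lt_le_trans _ _ (\int[leb]_(x in `[4^-1%R, 2^-1%R]) (fejer x `^ p)%:E)%E); last first.
  apply: ge0_subset_integral => //.
  by move=> x _; rewrite lee_fin powR_ge0.
apply: (@lt_le_trans _ _ (\int[leb]_(x in `[4^-1%R, 2^-1%R]) ((2 / pi ^+ 2) `^ p)%:E)%E).
  rewrite integral_cst//= lebesgue_measure_itv/= lte_fin ifT; last by lra.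
  by rewrite -EFinB -EFinM lte_fin mulr_gt0 ?powR_gt0//; lra.
apply: ge0_le_integral => //.
- by move=> x _; rewrite lee_fin powR_ge0.
- exact: measurable_funTS.
move=> x; rewrite /= in_itv/= => xI; rewrite lee_fin ge0_ler_powR ?nnegrE ?fejer_ge0 ?fejer_lower ?(ltW c0)//.
by lra.
Qed.

End Fejer.

(** * Complex-valued integrals *)

Section ComplexBasics.
Context {R : realType}.
Implicit Types z w : R[i].
Local Notation normc := Normc.normc.

Lemma complex_ReM z w : complex.Re (z * w) = complex.Re z * complex.Re w - complex.Im z * complex.Im w.
Proof. by case: z w => [a b] [c d]. Qed.

Lemma complex_ImM z w : complex.Im (z * w) = complex.Re z * complex.Im w + complex.Im z * complex.Re w.
Proof. by case: z w => [a b] [c d]. Qed.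

Lemma normc_ge0 z : 0 <= normc z.
Proof. by case: z => a b; exact: sqrtr_ge0. Qed.

Lemma normcE2 z : normc z = Num.sqrt (complex.Re z ^+ 2 + complex.Im z ^+ 2).
Proof. by case: z. Qed.

Lemma ler_Re_normc z : `|complex.Re z| <= normc z.
Proof. by rewrite normcE2 -sqrtr_sqr ler_wsqrtr// lerDl sqr_ge0. Qed.

Lemma ler_Im_normc z : `|complex.Im z| <= normc z.
Proof. by rewrite normcE2 -sqrtr_sqr ler_wsqrtr// lerDr sqr_ge0. Qed.

Lemma ler_normc_ReIm z : normc z <= `|complex.Re z| + `|complex.Im z|.
Proof.
rewrite normcE2 -[leRHS]ger0_norm ?addr_ge0// -sqrtr_sqr ler_wsqrtr//.
by rewrite sqrrD !real_normK ?num_real// lerD2r lerDl mulrn_wge0// mulr_ge0.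
Qed.

Lemma normc_real (a : R) : normc a%:C = `|a|.
Proof. by rewrite normcE2/= expr0n addr0 sqrtr_sqr. Qed.

Lemma expiD (s t : R) : expi (s + t) = expi s * expi t.
Proof. by rewrite /expi cosD sinD; simpc; rewrite [cos s * sin t + _]addrC. Qed.

Lemma expi0 : expi (0 : R) = 1.
Proof. by rewrite /expi cos0 sin0. Qed.

Lemma normc_expi (t : R) : normc (expi t) = 1.
Proof. by rewrite normcE2/= cos2Dsin2 sqrtr1. Qed.

End ComplexBasics.

Section ComplexMeasurable.
Context {R : realType} {d : measure_display} {T : measurableType d}.
Implicit Types f g : T -> R[i].
Local Notation normc := Normc.normc.
Local Notation mR := (measurableTypeR R).

Definition cmeas f : Prop :=
  measurable_fun [set: T] (fun x => complex.Re (f x) : mR) /\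
  measurable_fun [set: T] (fun x => complex.Im (f x) : mR).

Lemma cmeasM f g : cmeas f -> cmeas g -> cmeas (fun x => f x * g x).
Proof.
move=> [f1 f2] [g1 g2]; split.
  under eq_fun do rewrite complex_ReM.
  by apply: measurable_funB; exact: measurable_funM.
under eq_fun do rewrite complex_ImM.
by apply: measurable_funD; exact: measurable_funM.
Qed.

Lemma cmeas_real (h : T -> mR) : measurable_fun [set: T] h -> cmeas (fun x => (h x)%:C).
Proof. by move=> mh; split => //=; exact: measurable_cst. Qed.

Lemma cmeas_expi (h : T -> mR) : measurable_fun [set: T] h -> cmeas (fun x => expi (h x)).
Proof.
move=> mh; split => /=; apply: measurableT_comp => //.
  exact: continuous_measurable_fun (@continuous_cos R).
exact: continuous_measurable_fun (@continuous_sin R).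
Qed.

Lemma measurable_normc f : cmeas f -> measurable_fun [set: T] (fun x => normc (f x) : mR).
Proof.
move=> [f1 f2]; under eq_fun do rewrite normcE2.
apply: (@measurableT_comp _ _ _ _ _ _ (Num.sqrt : mR -> mR)).
  exact: continuous_measurable_fun (@sqrt_continuous R).
by apply: measurable_funD; exact: measurable_funX.
Qed.

Variable mu : {measure set T -> \bar R}.

Lemma cintegrableP f :
  cintegrable mu f <-> cmeas f /\ (\int[mu]_x (normc (f x))%:E < +oo)%E.
Proof.
split.
  move=> [f1 f2]; have cf : cmeas f.
    by split; apply/measurable_EFinP; [exact: measurable_int f1|exact: measurable_int f2].
  split=> //; have := integrableD measurableT (integrable_abse f1) (integrable_abse f2).
  move=> /integrableP[_]; apply: le_lt_trans; apply: ge0_le_integral => //.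
  - by move=> x _; rewrite lee_fin normc_ge0.
  - by apply/measurable_EFinP; exact: measurable_normc.
  - apply: measurableT_comp => //; apply: emeasurable_funD.
      by apply: measurableT_comp => //; exact: measurable_int f1.
    by apply: measurableT_comp => //; exact: measurable_int f2.
  - by move=> x _ /=; rewrite lee_fin; apply: le_trans (ler_norm _); exact: ler_normc_ReIm.
move=> [cf fi]; have mn := measurable_normc cf.
have : mu.-integrable setT (fun x => (normc (f x))%:E).
  apply/integrableP; split; first exact/measurable_EFinP.
  by under eq_integral => x _ do rewrite gee0_abs ?lee_fin ?normc_ge0//.
case: cf => f1 f2 ni; split; apply: le_integrable ni => //.
- exact/measurable_EFinP.
- by move=> x _ /=; rewrite lee_fin (ger0_norm (normc_ge0 _)) ler_Re_normc.
- exact/measurable_EFinP.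
- by move=> x _ /=; rewrite lee_fin (ger0_norm (normc_ge0 _)) ler_Im_normc.
Qed.

Lemma cintegrable_cmeas f : cintegrable mu f -> cmeas f.
Proof. by move=> /cintegrableP[]. Qed.

(** The triangle inequality for integrals. The factor 2 comes from estimating
the real and imaginary parts separately. *)
Lemma normc_cintegral_le f : cmeas f ->
  ((normc (cintegral mu f))%:E <= 2%:E * \int[mu]_x (normc (f x))%:E)%E.
Proof.
move=> cf; have [fi|] := boolP (\int[mu]_x (normc (f x))%:E < +oo)%E; last first.
  by rewrite -leNgt leye_eq => /eqP ->; rewrite gt0_muley ?leey// lte_fin.
have /cintegrableP[f1 f2] : cmeas f /\ (\int[mu]_x (normc (f x))%:E < +oo)%E by [].
apply: (@le_trans _ _ (`|complex.Re (cintegral mu f)| + `|complex.Im (cintegral mu f)|)%:E).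
  by rewrite lee_fin ler_normc_ReIm.
have mn : measurable_fun setT (fun x => (normc (f x))%:E).
  by apply/measurable_EFinP; exact: measurable_normc.
have aux (h : T -> R) : mu.-integrable setT (EFin \o h) -> (forall x, `|h x| <= normc (f x)) ->
    (`|\int[mu]_x h x|%:E <= \int[mu]_x (normc (f x))%:E)%E.
  move=> hi hn; have := le_abse_integral mu measurableT (measurable_int _ hi).
  rewrite /Rintegral -[X in (`|X| <= _)%E]fineK; last exact: integrable_fin_num hi.
  move=> H; apply: (le_trans H); apply: ge0_le_integral => //.
  - by apply: measurableT_comp => //; exact: measurable_int hi.
  - by move=> x _ /=; rewrite lee_fin.
rewrite EFinD mule_natl mule2n leeD//=.
  by apply: aux => // x; exact: ler_Re_normc.
by apply: aux => // x; exact: ler_Im_normc.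
Qed.

Lemma cintegralZl (c : R[i]) f : cintegrable mu f ->
  cintegral mu (fun x => c * f x) = c * cintegral mu f.
Proof.
move=> [f1 f2]; case: c => a b; rewrite /cintegral; simpc.
have i1 k := integrableZl measurableT k f1.
have i2 k := integrableZl measurableT k f2.
congr Complex.
  under eq_Rintegral do rewrite complex_ReM/=.
  by rewrite RintegralB; [rewrite !RintegralZl|by []|exact: i1|exact: i2].
under eq_Rintegral do rewrite complex_ImM/=.
by rewrite RintegralD; [rewrite !RintegralZl|by []|exact: i2|exact: i1].
Qed.

Lemma cintegrableZl (c : R[i]) f : cintegrable mu f -> cintegrable mu (fun x => c * f x).
Proof.
move=> /cintegrableP[cf fi]; apply/cintegrableP; split.
  by apply: cmeasM => //; split; exact: measurable_cst.
under eq_integral do rewrite Normc.normcM EFinM.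
rewrite ge0_integralZl_EFin ?normc_ge0//.
- by rewrite lte_mul_pinfty// lee_fin normc_ge0.
- by move=> x _; rewrite lee_fin normc_ge0.
- by apply/measurable_EFinP; exact: measurable_normc.
Qed.

Lemma scales_cintegral k phi f : scales mu k phi -> cintegrable mu f ->
  cintegral mu (fun x => f (phi x)) = k%:C * cintegral mu f.
Proof.
move=> sc [f1 f2]; rewrite /cintegral; simpc.
rewrite /Rintegral (scales_integral sc f1) (scales_integral sc f2).
by rewrite !fineM// ?(integrable_fin_num _ f1) ?(integrable_fin_num _ f2)//= mulr0 mul0r subr0 addr0.
Qed.

End ComplexMeasurable.

Section ComplexFubini.
Context {R : realType} {d1 d2 : measure_display}.
Context {X : measurableType d1} {Y : measurableType d2}.
Variable mu : {sigma_finite_measure set X -> \bar R}.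
Variable nu : {sigma_finite_measure set Y -> \bar R}.
Local Notation normc := Normc.normc.

Lemma Rintegral_prod1 (f : X * Y -> R) : (mu \x nu)%E.-integrable setT (EFin \o f) ->
  \int[mu]_x (\int[nu]_y f (x, y)) = \int[(mu \x nu)%E]_z f z.
Proof.
move=> fi; rewrite /Rintegral; congr fine.
rewrite -(integral12_prod_meas1 fi); apply: ae_eq_integral => //.
- apply/measurable_EFinP; apply: measurableT_comp => //; exact: measurable_fubini_F fi.
- exact: measurable_fubini_F fi.
- have := ae_integrable1 fi; apply: filterS => x fx _ /=.
  by rewrite fineK//; exact: integrable_fin_num fx.
Qed.

Lemma Rintegral_prod2 (f : X * Y -> R) : (mu \x nu)%E.-integrable setT (EFin \o f) ->
  \int[nu]_y (\int[mu]_x f (x, y)) = \int[(mu \x nu)%E]_z f z.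
Proof.
move=> fi; rewrite /Rintegral; congr fine.
rewrite -(integral21_prod_meas1 fi); apply: ae_eq_integral => //.
- apply/measurable_EFinP; apply: measurableT_comp => //; exact: measurable_fubini_G fi.
- exact: measurable_fubini_G fi.
- have := ae_integrable2 fi; apply: filterS => x fx _ /=.
  by rewrite fineK//; exact: integrable_fin_num fx.
Qed.

Lemma cintegral_prod1 (f : X * Y -> R[i]) : cintegrable (mu \x nu)%E f ->
  cintegral mu (fun x => cintegral nu (fun y => f (x, y))) = cintegral (mu \x nu)%E f.
Proof.
by move=> [f1 f2]; rewrite /cintegral; congr Complex;
  [exact: Rintegral_prod1 f1|exact: Rintegral_prod1 f2].
Qed.

Lemma cintegral_prod2 (f : X * Y -> R[i]) : cintegrable (mu \x nu)%E f ->
  cintegral nu (fun y => cintegral mu (fun x => f (x, y))) = cintegral (mu \x nu)%E f.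
Proof.
by move=> [f1 f2]; rewrite /cintegral; congr Complex;
  [exact: Rintegral_prod2 f1|exact: Rintegral_prod2 f2].
Qed.

Lemma ge0_integral_prodM (f : X -> R) (g : Y -> R) :
  measurable_fun [set: X] f -> measurable_fun [set: Y] g ->
  (forall x, 0 <= f x) -> (forall y, 0 <= g y) ->
  (\int[mu \x nu]_z (f z.1 * g z.2)%:E = \int[mu]_x (f x)%:E * \int[nu]_y (g y)%:E)%E.
Proof.
move=> mf mg f0 g0; rewrite fubini_tonelli1//=; last 2 first.
- apply/measurable_EFinP; apply: measurable_funM; exact: measurableT_comp.
- by move=> z; rewrite lee_fin mulr_ge0.
rewrite /fubini_F/=.
under eq_integral => x _.
  under eq_integral do rewrite EFinM.
  rewrite ge0_integralZl_EFin//; last 2 first.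
  - by move=> y _; rewrite lee_fin.
  - exact/measurable_EFinP.
  over.
rewrite ge0_integralZr//.
- exact/measurable_EFinP.
- by move=> x _; rewrite lee_fin.
- by apply: integral_ge0 => y _; rewrite lee_fin.
Qed.

Lemma cmeas_fst (f : X -> R[i]) : cmeas f -> cmeas (fun z : X * Y => f z.1).
Proof. by move=> [f1 f2]; split; [exact: measurableT_comp f1 _|exact: measurableT_comp f2 _]. Qed.

Lemma cmeas_snd (f : Y -> R[i]) : cmeas f -> cmeas (fun z : X * Y => f z.2).
Proof. by move=> [f1 f2]; split; [exact: measurableT_comp f1 _|exact: measurableT_comp f2 _]. Qed.

Lemma cintegrable_prodM (f : X -> R[i]) (g : Y -> R[i]) :
  cintegrable mu f -> cintegrable nu g ->
  cintegrable (mu \x nu)%E (fun z => f z.1 * g z.2).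
Proof.
move=> /cintegrableP[cf fi] /cintegrableP[cg gi]; apply/cintegrableP; split.
  by apply: cmeasM; [exact: cmeas_fst|exact: cmeas_snd].
under eq_integral do rewrite Normc.normcM.
rewrite /= (@ge0_integral_prodM (fun x => normc (f x)) (fun y => normc (g y))).
- apply: lte_mul_pinfty => //; first by apply: integral_ge0 => x _; rewrite lee_fin normc_ge0.
  by rewrite ge0_fin_numE//; apply: integral_ge0 => x _; rewrite lee_fin normc_ge0.
- exact: measurable_normc.
- exact: measurable_normc.
- by move=> x; exact: normc_ge0.
- by move=> x; exact: normc_ge0.
Qed.

Lemma cintegral_prodM (f : X -> R[i]) (g : Y -> R[i]) :
  cintegrable mu f -> cintegrable nu g ->
  cintegral (mu \x nu)%E (fun z => f z.1 * g z.2) = cintegral mu f * cintegral nu g.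
Proof.
move=> fi gi; rewrite -cintegral_prod1; last exact: cintegrable_prodM.
rewrite /= [RHS]mulrC -cintegralZl//; congr cintegral; apply/funext => x.
by rewrite cintegralZl// mulrC.
Qed.

End ComplexFubini.

(** * Lebesgue measure in dimensions three and four *)

Section SigmaFiniteProduct.
Context {R : realType} {d1 d2 : measure_display}.
Context {X : measurableType d1} {Y : measurableType d2}.
Variable mu : {sigma_finite_measure set X -> \bar R}.
Variable nu : {sigma_finite_measure set Y -> \bar R}.

Lemma sigma_finite_prod : sigma_finite setT (mu \x nu)%E.
Proof.
have /sigma_finiteP[F [TF ndF Foo]] := sigma_finiteT mu.
have /sigma_finiteP[G [TG ndG Goo]] := sigma_finiteT nu.
exists (fun n => F n `*` G n).
  rewrite -setXTT TF TG; apply/seteqP; split=> -[x y].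
    move=> [/= [n _ Fnx] [k _ Gky]]; exists (maxn n k) => //; split.
      by move: x Fnx; exact/subsetPset/ndF/leq_maxl.
    by move: y Gky; exact/subsetPset/ndG/leq_maxr.
  by move=> [n _ []/= ? ?]; split; exists n.
move=> k; have [? ?] := Foo k; have [? ?] := Goo k.
split; first exact: measurableX.
by rewrite product_measure1E// lte_mul_pinfty// ge0_fin_numE.
Qed.

(** The product measure bundled with its sigma-finiteness, so that it can serve
as a factor of a further product. *)
Definition prod_sigma_finite : {sigma_finite_measure set (X * Y)%type -> \bar R} :=
  HB.pack (mu \x nu)%E (Measure_isSigmaFinite.Build _ _ _ (mu \x nu)%E sigma_finite_prod).

End SigmaFiniteProduct.

Section Lebesgue34.
Context {R : realType}.
Local Notation leb := (@lebesgue_measure R).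
Local Notation mR := (measurableTypeR R).
Local Notation mR3 := (mR * mR * mR)%type.
Local Notation mR4 := (mR * mR * mR * mR)%type.

Definition sleb : {sigma_finite_measure set mR -> \bar R} := leb.
Definition sleb2 : {sigma_finite_measure set (mR * mR)%type -> \bar R} := prod_sigma_finite sleb sleb.
Definition sleb3 : {sigma_finite_measure set mR3 -> \bar R} := prod_sigma_finite sleb2 sleb.

Lemma leb3E : (leb3 : {measure set mR3 -> \bar R}) = sleb3. Proof. by []. Qed.
Lemma leb3E2 : (leb3 : {measure set mR3 -> \bar R}) = (sleb2 \x sleb)%E. Proof. by []. Qed.
Lemma leb4E : (leb4 : {measure set mR4 -> \bar R}) = (sleb3 \x sleb)%E. Proof. by []. Qed.

Lemma scales_leb3 (k l m : R) (phi psi chi : mR -> mR) :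
  scales leb k phi -> scales leb l psi -> scales leb m chi ->
  scales leb3 (k * l * m) (fun x : mR3 => (phi x.1.1, psi x.1.2, chi x.2) : mR3).
Proof.
move=> h1 h2 h3; rewrite leb3E2.
apply: (@scales_prod R _ _ _ _ sleb2 sleb (k * l) m (fun x => (phi x.1, psi x.2)) chi) => //.
exact: (@scales_prod R _ _ _ _ sleb sleb).
Qed.

Lemma scales_leb4 (k l : R) (phi : mR3 -> mR3) (psi : mR -> mR) :
  scales leb3 k phi -> scales leb l psi ->
  scales leb4 (k * l) (fun x : mR4 => (phi x.1, psi x.2) : mR4).
Proof. by move=> h1 h2; rewrite leb4E; exact: (@scales_prod R _ _ _ _ sleb3 sleb). Qed.

Lemma scales_leb3_translation (c : R3 R) : scales leb3 1 (fun x : mR3 => x + c : mR3).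
Proof.
have := scales_leb3 (scales_translation c.1.1) (scales_translation c.1.2) (scales_translation c.2).
by rewrite !mulr1.
Qed.

Lemma scales_leb4_translation (c : R3 R) : scales leb4 1 (fun x : mR4 => (x.1 + c, x.2) : mR4).
Proof.
have := scales_leb4 (scales_leb3_translation c) (scales_translation 0).
by rewrite mulr1; congr scales; apply/funext => x; rewrite addr0.
Qed.

Lemma scales_leb4_shear (v : R3 R) :
  scales leb4 1 (fun x : mR4 => (x.1 + x.2 *: v, x.2) : mR4).
Proof.
rewrite leb4E; apply: (@scales_skewl R _ _ _ _ sleb3 sleb 1 (fun x => x.1 + x.2 *: v)) => //.
  by do 2?[apply: measurable_fun_pair]; apply: measurable_funD;
    do ?[apply: measurable_funM => //]; repeat apply: measurableT_comp => //.
by move=> t; exact: (scales_leb3_translation (t *: v)).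
Qed.

Lemma scales_leb3_shear (r a b : R) : 0 < r ->
  scales leb3 r^-1 (fun x : mR3 => (x.1, r * (x.2 + (a * x.1.1 + b * x.1.2))) : mR3).
Proof.
move=> r0; rewrite leb3E2.
apply: (@scales_skewr R _ _ _ _ sleb2 sleb r^-1 (fun x => r * (x.2 + (a * x.1.1 + b * x.1.2)))).
- by rewrite invr_gt0.
- apply: measurable_funM => //; apply: measurable_funD => //.
  by apply: measurable_funD; apply: measurable_funM => //; repeat apply: measurableT_comp => //.
- move=> x; have := scales_affine (r * (a * x.1 + b * x.2)) (lt0r_neq0 r0).
  rewrite gtr0_norm//; congr scales; apply/funext => t/=.
  exact: (esym (mulrDr r (t : R) _)).
Qed.

Lemma scales_leb3_dilation (k : R) (c : R3 R) : 0 < k ->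
  scales leb3 (k ^+ 3)^-1 (fun x : mR3 => k *: x + c : mR3).
Proof.
move=> k0; have kn : k != 0 by rewrite lt0r_neq0.
have := scales_leb3 (scales_affine c.1.1 kn) (scales_affine c.1.2 kn) (scales_affine c.2 kn).
rewrite gtr0_norm// (_ : k^-1 * k^-1 * k^-1 = (k ^+ 3)^-1)//.
by rewrite -!invfM -expr2 -exprSr.
Qed.

Lemma leb3_box (A B C : set mR) : measurable A -> measurable B -> measurable C ->
  leb3 (A `*` B `*` C) = (leb A * leb B * leb C)%E.
Proof.
move=> mA mB mC; rewrite leb3E2/= product_measure1E//=; last exact: measurableX.
by rewrite [sleb2 _]product_measure1E.
Qed.

Definition cube3 : set mR3 :=
  (`[(-1)%R, 1%R]%classic `*` `[(-1)%R, 1%R]%classic `*` `[(-1)%R, 1%R]%classic).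

Lemma measurable_cube3 : measurable cube3.
Proof. by apply: measurableX => //; exact: measurableX. Qed.

Lemma leb3_cube3 : leb3 cube3 = 8%:E.
Proof.
rewrite /cube3 leb3_box// lebesgue_measure_itv/= lte_fin ifT; last by lra.
by rewrite -EFinB -!EFinM; congr EFin; ring.
Qed.

(** For a between 0 and 1 this is a zero of the form x1^2 + x2^2 - x3^2. *)
Definition null_dir (a : R) : R3 R := (a, Num.sqrt (1 - a ^+ 2), 1).

(** Parametrizes, by the cube of side 2, a tube of width of order eta around the
segment from - r n to r n. *)
Definition tube_map (eta r : R) (n z : R3 R) : R3 R :=
  (eta * z.1.1, eta * z.1.2, 0) + (r * z.2) *: n.

(** The transpose of tube_map (see dot3_tube_map): it acts on the space side as
tube_map acts on the frequency side. *)
Definition tube_adj (eta r : R) (n y : R3 R) : R3 R :=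
  (eta * y.1.1, eta * y.1.2, r * (y.2 + (n.1.1 * y.1.1 + n.1.2 * y.1.2))).

Lemma dot3_tube_map eta r n y z : n.2 = 1 ->
  dot3 y (tube_map eta r n z) = dot3 (tube_adj eta r n y) z.
Proof. by move=> n1; rewrite /dot3 /tube_map /tube_adj/= /GRing.scale/= n1; ring. Qed.

Lemma dot3D (x y z : R3 R) : dot3 (x + y) z = dot3 x z + dot3 y z.
Proof. by rewrite /dot3/=; ring. Qed.

Lemma dot3Dr (x y z : R3 R) : dot3 x (y + z) = dot3 x y + dot3 x z.
Proof. by rewrite /dot3/=; ring. Qed.

Lemma dot3N (x z : R3 R) : dot3 (- x) z = - dot3 x z.
Proof. by rewrite /dot3/=; ring. Qed.

Lemma dot3Z (k : R) (x z : R3 R) : dot3 (k *: x) z = k * dot3 x z.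
Proof. by rewrite /dot3/= /GRing.scale/=; ring. Qed.

Lemma scales_tube_adj (eta r : R) n : 0 < eta -> 0 < r ->
  scales leb3 (eta ^- 2 * r^-1) (tube_adj eta r n : mR3 -> mR3).
Proof.
move=> e0 r0; have en := lt0r_neq0 e0.
have := scales_comp (scales_leb3_shear n.1.1 n.1.2 r0)
  (scales_leb3 (scales_affine 0 en) (scales_affine 0 en) (scales_translation 0)).
rewrite gtr0_norm// mulr1 (_ : r^-1 * _ = eta ^- 2 * r^-1); last by rewrite expr2 invfM mulrC.
by congr scales; apply/funext => -[[y1 y2] y3]; rewrite /tube_adj/= !addr0.
Qed.

Definition tri3 (z : mR3) : R := tri z.1.1 * tri z.1.2 * tri z.2.
Definition fejer3 (z : mR3) : R := fejer z.1.1 * fejer z.1.2 * fejer z.2.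
Definition fejer4 (z : mR4) : R := fejer3 z.1 * fejer z.2.

Lemma cintegrable_tri (t : R) :
  cintegrable leb (fun x : mR => (tri x)%:C * expi (2 * pi * (t * x))).
Proof.
split => /=; under eq_fun do [rewrite ?complex_ReM ?complex_ImM/= mul0r ?subr0 ?addr0 mulrA].
  exact: integrable_tri_cos.
apply: (integrableM_le1 integrable_tri); first exact: measurable_sin_lin.
by move=> x; exact: sin_max.
Qed.

Lemma cintegral_tri (t : R) :
  cintegral leb (fun x : mR => (tri x)%:C * expi (2 * pi * (t * x))) = (fejer t)%:C.
Proof.
rewrite /cintegral /Rintegral; congr Complex.
  rewrite -[RHS]/(fine (fejer t)%:E) -integral_tri_cos; congr fine.
  by apply: eq_integral => x _; rewrite complex_ReM/= mul0r subr0 mulrA.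
under eq_integral do rewrite complex_ImM/= mul0r addr0 mulrA.
rewrite integral_odd//; first by move=> x; rewrite triN mulrN sinN mulrN.
apply: (integrableM_le1 integrable_tri); first exact: measurable_sin_lin.
by move=> x; exact: sin_max.
Qed.

Let tri3_split (y z : R3 R) : (tri3 z)%:C * expi (2 * pi * dot3 y z) =
  (tri z.1.1)%:C * expi (2 * pi * (y.1.1 * z.1.1)) *
  ((tri z.1.2)%:C * expi (2 * pi * (y.1.2 * z.1.2))) *
  ((tri z.2)%:C * expi (2 * pi * (y.2 * z.2))).
Proof.
rewrite /dot3 !mulrDr !expiD /tri3 !rmorphM/=; ring.
Qed.

Lemma cintegrable_tri3 (y : R3 R) :
  cintegrable leb3 (fun z : mR3 => (tri3 z)%:C * expi (2 * pi * dot3 y z)).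
Proof.
under eq_fun do rewrite tri3_split.
rewrite leb3E2; apply: (@cintegrable_prodM R _ _ _ _ sleb2 sleb
  (fun z => (tri z.1)%:C * expi (2 * pi * (y.1.1 * z.1)) * ((tri z.2)%:C * expi (2 * pi * (y.1.2 * z.2))))
  (fun t => (tri t)%:C * expi (2 * pi * (y.2 * t)))).
  apply: (@cintegrable_prodM R _ _ _ _ sleb sleb
    (fun t => (tri t)%:C * expi (2 * pi * (y.1.1 * t)))
    (fun t => (tri t)%:C * expi (2 * pi * (y.1.2 * t)))); exact: cintegrable_tri.
exact: cintegrable_tri.
Qed.

(** This expansion of the kernel into characters with frequencies in the cube is
substituted for the spatial part of a packet in box_part_swap. *)
Lemma cintegral_tri3 (y : R3 R) :
  cintegral leb3 (fun z : mR3 => (tri3 z)%:C * expi (2 * pi * dot3 y z)) = (fejer3 y)%:C.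
Proof.
under eq_fun do rewrite tri3_split.
rewrite leb3E2 (@cintegral_prodM R _ _ _ _ sleb2 sleb
  (fun z => (tri z.1)%:C * expi (2 * pi * (y.1.1 * z.1)) * ((tri z.2)%:C * expi (2 * pi * (y.1.2 * z.2))))
  (fun t => (tri t)%:C * expi (2 * pi * (y.2 * t)))).
- rewrite (@cintegral_prodM R _ _ _ _ sleb sleb
    (fun t => (tri t)%:C * expi (2 * pi * (y.1.1 * t)))
    (fun t => (tri t)%:C * expi (2 * pi * (y.1.2 * t)))); try exact: cintegrable_tri.
  by rewrite !cintegral_tri /fejer3 !rmorphM.
- apply: (@cintegrable_prodM R _ _ _ _ sleb sleb
    (fun t => (tri t)%:C * expi (2 * pi * (y.1.1 * t)))
    (fun t => (tri t)%:C * expi (2 * pi * (y.1.2 * t)))); exact: cintegrable_tri.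
- exact: cintegrable_tri.
Qed.

Definition fejer_hat (u : R) : R[i] :=
  cintegral leb (fun t : mR => (fejer t)%:C * expi (- (2 * pi * (t * u)))).

Lemma cintegrable_fejer (u : R) :
  cintegrable leb (fun t : mR => (fejer t)%:C * expi (- (2 * pi * (t * u)))).
Proof.
apply/cintegrableP; split.
  apply: cmeasM; first by apply: cmeas_real; exact: measurable_fejer.
  apply: cmeas_expi; apply: measurableT_comp => //.
  by apply: measurable_funM => //; exact: measurable_funM.
under eq_integral do rewrite Normc.normcM normc_expi mulr1 normc_real ger0_norm ?fejer_ge0//.
by rewrite integral_fejer ltry.
Qed.

Lemma fejer_hat_eq0 (u : R) : 1 <= `|u| -> fejer_hat u = 0.
Proof.
move=> u1; rewrite /fejer_hat /cintegral /Rintegral.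
under eq_integral do rewrite complex_ReM/= mul0r subr0 cosN (mulrC _ u) mulrA.
rewrite integral_fejer_cos//=.
under eq_integral => t _.
  rewrite mul0r addr0 (_ : - (2 * pi * (t * u)) = 2 * pi * (- u) * t); last by ring.
  over.
by rewrite integral_fejer_sin.
Qed.

Lemma fejer3_ge0 z : 0 <= fejer3 z. Proof. by rewrite /fejer3 !mulr_ge0 ?fejer_ge0. Qed.
Lemma fejer4_ge0 z : 0 <= fejer4 z. Proof. by rewrite /fejer4 mulr_ge0 ?fejer3_ge0 ?fejer_ge0. Qed.

Let fejer4_split (z P : R4 R) : (fejer4 z)%:C * expi (- (2 * pi * dot4 z P)) =
  ((fejer z.1.1.1)%:C * expi (- (2 * pi * (z.1.1.1 * P.1.1.1))) *
  ((fejer z.1.1.2)%:C * expi (- (2 * pi * (z.1.1.2 * P.1.1.2)))) *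
  ((fejer z.1.2)%:C * expi (- (2 * pi * (z.1.2 * P.1.2))))) *
  ((fejer z.2)%:C * expi (- (2 * pi * (z.2 * P.2)))).
Proof.
by rewrite /dot4 /dot3 !mulrDr !opprD !expiD /fejer4 /fejer3 !rmorphM/=; ring.
Qed.

Let fej u (t : mR) : R[i] := (fejer t)%:C * expi (- (2 * pi * (t * u))).

Let fej2 (P : R4 R) (z : mR * mR) := fej P.1.1.1 z.1 * fej P.1.1.2 z.2.
Let fej3 (P : R4 R) (z : mR3) := fej2 P z.1 * fej P.1.2 z.2.

Let cintegrable_fej2 P : cintegrable sleb2 (fej2 P).
Proof.
by apply: (@cintegrable_prodM R _ _ _ _ sleb sleb (fej P.1.1.1) (fej P.1.1.2)); exact: cintegrable_fejer.
Qed.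

Let cintegrable_fej3 P : cintegrable sleb3 (fej3 P).
Proof.
apply: (@cintegrable_prodM R _ _ _ _ sleb2 sleb (fej2 P) (fej P.1.2)).
  exact: cintegrable_fej2.
exact: cintegrable_fejer.
Qed.

Lemma cintegrable_fejer4 (P : R4 R) :
  cintegrable leb4 (fun z : mR4 => (fejer4 z)%:C * expi (- (2 * pi * dot4 z P))).
Proof.
under eq_fun do rewrite fejer4_split.
rewrite leb4E; apply: (@cintegrable_prodM R _ _ _ _ sleb3 sleb (fej3 P) (fej P.2)).
  exact: cintegrable_fej3.
exact: cintegrable_fejer.
Qed.

Lemma cintegral_fejer4 (P : R4 R) :
  cintegral leb4 (fun z : mR4 => (fejer4 z)%:C * expi (- (2 * pi * dot4 z P))) =
  fejer_hat P.1.1.1 * fejer_hat P.1.1.2 * fejer_hat P.1.2 * fejer_hat P.2.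
Proof.
under eq_fun do rewrite fejer4_split.
rewrite leb4E (@cintegral_prodM R _ _ _ _ sleb3 sleb (fej3 P) (fej P.2)); last 2 first.
- exact: cintegrable_fej3.
- exact: cintegrable_fejer.
congr (_ * _).
rewrite [LHS](@cintegral_prodM R _ _ _ _ sleb2 sleb (fej2 P) (fej P.1.2)); last 2 first.
- exact: cintegrable_fej2.
- exact: cintegrable_fejer.
congr (_ * _).
by rewrite [LHS](@cintegral_prodM R _ _ _ _ sleb sleb (fej P.1.1.1) (fej P.1.1.2)); try exact: cintegrable_fejer.
Qed.

Lemma integral_fejer4_powR (p : R) : 1 <= p ->
  (\int[leb4]_z (fejer4 z `^ p)%:E = ((fejer_pmass p) ^+ 4)%:E)%E.
Proof.
move=> p1; have mf := measurable_int _ (integrable_fejer_powR p1).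
have {}mf : measurable_fun setT (fun x : mR => fejer x `^ p) by exact/measurable_EFinP.
have f0 (x : mR) : 0 <= fejer x `^ p by exact: powR_ge0.
have m2 : measurable_fun setT (fun z : mR * mR => fejer z.1 `^ p * fejer z.2 `^ p).
  by apply: measurable_funM; exact: measurableT_comp mf _.
have m3 : measurable_fun setT (fun z : mR3 => fejer z.1.1 `^ p * fejer z.1.2 `^ p * fejer z.2 `^ p).
  apply: measurable_funM; last exact: measurableT_comp mf _.
  exact: measurableT_comp m2 _.
under eq_integral do rewrite /fejer4 /fejer3 !powRM ?mulr_ge0 ?fejer_ge0//.
rewrite leb4E (@ge0_integral_prodM R _ _ _ _ sleb3 sleb
  (fun z => fejer z.1.1 `^ p * fejer z.1.2 `^ p * fejer z.2 `^ p) (fun t => fejer t `^ p))//; last first.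
  by move=> z; rewrite !mulr_ge0.
rewrite [X in (X * _)%E](@ge0_integral_prodM R _ _ _ _ sleb2 sleb
  (fun z => fejer z.1 `^ p * fejer z.2 `^ p) (fun t => fejer t `^ p))//; last first.
  by move=> z; rewrite !mulr_ge0.
rewrite [X in (X * _ * _)%E](@ge0_integral_prodM R _ _ _ _ sleb sleb
  (fun t => fejer t `^ p) (fun t => fejer t `^ p))//.
by rewrite /sleb/= integral_fejer_powR// -!EFinM; congr EFin; ring.
Qed.

Lemma measurable_fejer3 : measurable_fun setT (fejer3 : mR3 -> mR).
Proof.
by do 2?[apply: measurable_funM]; apply: (measurableT_comp measurable_fejer); repeat apply: measurableT_comp => //.
Qed.

Lemma measurable_fejer4 : measurable_fun setT (fejer4 : mR4 -> mR).
Proof.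
apply: measurable_funM; first exact: (measurableT_comp measurable_fejer3).
exact: (measurableT_comp measurable_fejer).
Qed.

End Lebesgue34.

(** * Wave packets along null segments *)

Section WavePacket.
Context {R : realType}.
Local Notation mR := (measurableTypeR R).
Local Notation mR3 := (mR * mR * mR)%type.
Local Notation mR4 := (mR * mR * mR * mR)%type.
Local Notation normc := Normc.normc.

Definition hyperbolic_grad (xi : R3 R) : R3 R := (2 * xi.1.1, 2 * xi.1.2, - 2 * xi.2).

(** The shear in the first component follows the normal of the tangent plane at
xi0. It makes the Fourier transform concentrate near that plane. *)
Definition packet_map (eta r : R) (n xi0 : R3 R) (x : R4 R) : R4 R :=
  (tube_adj eta r n (x.1 + x.2 *: hyperbolic_grad xi0), eta * x.2).

Definition packet_phase (xi0 : R3 R) (x : R4 R) : R :=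
  2 * pi * (dot3 x.1 xi0 + x.2 * hyperbolic_form xi0).

(** Its modulus is of size 1 on a box of the dimensions dual to those of the
tube, and its Fourier transform lives over the tube of direction n around xi0. *)
Definition packet (eta r : R) (n xi0 : R3 R) (x : R4 R) : R[i] :=
  (fejer4 (packet_map eta r n xi0 x))%:C * expi (packet_phase xi0 x).

(** The coordinates (p, q, s, w) of a frequency X: the projection of X is xi0 +
tube_map (p, q, s) when n has last coordinate 1, and eta w is the height of X
above the tangent plane at xi0. *)
Definition packet_freq (eta r : R) (n xi0 : R3 R) (X : R4 R) : R4 R :=
  let d := X.1 - xi0 in
  ((d.1.1 - n.1.1 * d.2) / eta, (d.1.2 - n.1.2 * d.2) / eta, d.2 / r,
   (X.2 - hyperbolic_form xi0 - dot3 (hyperbolic_grad xi0) d) / eta).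

(** The inverse of the Jacobian determinant of packet_map. *)
Definition packet_scale (eta r : R) : R := eta ^- 2 * r^-1 * eta^-1.

Lemma continuous_coord4 :
  [/\ continuous (fun X : R4 R => X.1.1.1), continuous (fun X : R4 R => X.1.1.2),
      continuous (fun X : R4 R => X.1.2) & continuous (fun X : R4 R => X.2)].
Proof.
have cf (A B : topologicalType) : continuous (@fst A B) by move=> x; exact: cvg_fst.
have cs (A B : topologicalType) : continuous (@snd A B) by move=> x; exact: cvg_snd.
have c1 : continuous (fun X : R4 R => X.1) by exact: cf.
have c2 : continuous (fun X : R4 R => X.1.1).
  by move=> X; apply: continuous_comp (c1 X) (cf _ _ _).
split=> X; last exact: cs.
- exact: continuous_comp (c2 X) (cf _ _ _).
- exact: continuous_comp (c2 X) (cs _ _ _).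
- exact: continuous_comp (c1 X) (cs _ _ _).
Qed.

Lemma closed_norm_affine (f : R4 R -> R) (k1 k2 k3 k4 k : R) :
  (forall X, f X = k1 * X.1.1.1 + k2 * X.1.1.2 + k3 * X.1.2 + k4 * X.2 + k) ->
  closed [set X | `|f X| <= 1].
Proof.
move=> fE; have [c1 c2 c3 c4] := continuous_coord4.
have cf : continuous (fun X => `|f X|).
  move=> X; apply: (@continuous_comp _ _ _ f (fun t => `|t|)); last exact: norm_continuous.
  have -> : f = fun X => k1 * X.1.1.1 + k2 * X.1.1.2 + k3 * X.1.2 + k4 * X.2 + k by apply/funext.
  do 4?[apply: cvgD]; try exact: cvg_cst; apply: cvgM; try exact: cvg_cst.
  - exact: c1.
  - exact: c2.
  - exact: c3.
  - exact: c4.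
exact: (preimage_closed (f := fun X => `|f X|) (D := [set t | t <= 1])) (fun X _ => cf X) (@closed_le _ _).
Qed.

Section Fixed.
Variables (eta r : R) (n xi0 : R3 R).
Hypotheses (eta0 : 0 < eta) (r0 : 0 < r) (n2 : n.2 = 1).

Lemma packet_scale_gt0 : 0 < packet_scale eta r.
Proof. by rewrite /packet_scale !mulr_gt0// ?invr_gt0// exprn_gt0. Qed.

Lemma scales_packet_map :
  scales leb4 (packet_scale eta r) (packet_map eta r n xi0 : mR4 -> mR4).
Proof.
have en := lt0r_neq0 eta0.
have := scales_comp (scales_leb4_shear (hyperbolic_grad xi0))
  (scales_leb4 (scales_tube_adj n eta0 r0) (scales_affine 0 en)).
rewrite gtr0_norm// mul1r; congr scales.
by apply/funext => x; rewrite /packet_map/= addr0.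
Qed.

Lemma measurable_dot3 (xi : R3 R) : measurable_fun setT (fun x : mR3 => dot3 x xi : mR).
Proof.
by rewrite /dot3; do 2?[apply: measurable_funD]; apply: measurable_funM => //;
  repeat apply: measurableT_comp => //.
Qed.

Lemma measurable_packet_phase : measurable_fun setT (packet_phase xi0 : mR4 -> mR).
Proof.
apply: measurable_funM => //; apply: measurable_funD.
  exact: measurableT_comp (measurable_dot3 xi0) _.
exact: measurable_funM.
Qed.

Lemma cmeas_packet : cmeas (packet eta r n xi0 : mR4 -> R[i]).
Proof.
have [_ ms _] := scales_packet_map.
apply: cmeasM; last by apply: cmeas_expi; exact: measurable_packet_phase.
by apply: cmeas_real; exact: (measurableT_comp measurable_fejer4).
Qed.

Lemma normc_packet x : normc (packet eta r n xi0 x) = fejer4 (packet_map eta r n xi0 x).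
Proof.
by rewrite Normc.normcM normc_expi mulr1 normc_real ger0_norm// fejer4_ge0.
Qed.

Lemma integral_packet_powR (p : R) : 1 <= p ->
  (\int[leb4]_x (normc (packet eta r n xi0 x) `^ p)%:E =
   (packet_scale eta r * fejer_pmass p ^+ 4)%:E)%E.
Proof.
move=> p1; under eq_integral do rewrite normc_packet.
rewrite (scales_ge0_integral (f := fun x : mR4 => (fejer4 x `^ p)%:E) scales_packet_map).
- by rewrite integral_fejer4_powR.
- apply/measurable_EFinP; exact: (measurableT_comp (measurable_powR _) measurable_fejer4).
- by move=> x; rewrite lee_fin powR_ge0.
Qed.

Lemma integral_normc_packet :
  (\int[leb4]_x (normc (packet eta r n xi0 x))%:E =
   (packet_scale eta r * fejer_pmass 1 ^+ 4)%:E)%E.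
Proof.
rewrite -integral_packet_powR//; apply: eq_integral => x _.
by rewrite powRr1// normc_ge0.
Qed.

Lemma cintegrable_packet : cintegrable leb4 (packet eta r n xi0).
Proof.
apply/cintegrableP; split; first exact: cmeas_packet.
by rewrite integral_normc_packet ltry.
Qed.

(** Once the phase of the packet is removed, packet_freq acts as the inverse
transpose of packet_map. *)
Lemma packet_freqE x X :
  dot4 x X - (dot3 x.1 xi0 + x.2 * hyperbolic_form xi0) =
  dot4 (packet_map eta r n xi0 x) (packet_freq eta r n xi0 X).
Proof.
have en := lt0r_neq0 eta0; have rn := lt0r_neq0 r0.
move: x X xi0 => [[[x1 x2] x3] x4] [[[X1 X2] X3] X4] [[y1 y2] y3].
rewrite /dot4 /packet_map /packet_freq /dot3 /tube_adj /hyperbolic_grad /hyperbolic_form/=.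
rewrite /GRing.scale/=; field; by rewrite en rn.
Qed.

(** A change of variables in the Fourier integral of the kernel. *)
Lemma fourier4_packet X : let P := packet_freq eta r n xi0 X in
  fourier4 (packet eta r n xi0) X = (packet_scale eta r)%:C *
   (fejer_hat P.1.1.1 * fejer_hat P.1.1.2 * fejer_hat P.1.2 * fejer_hat P.2).
Proof.
move=> P; rewrite /fourier4 -cintegral_fejer4.
rewrite -(scales_cintegral scales_packet_map); last exact: cintegrable_fejer4.
congr cintegral; apply/funext => x; rewrite /packet -mulrA -expiD -packet_freqE.
by congr (_ * expi _); rewrite /packet_phase; ring.
Qed.

Definition packet_region : set (R4 R) :=
  [set X | let P := packet_freq eta r n xi0 X in
   [/\ `|P.1.1.1| <= 1, `|P.1.1.2| <= 1, `|P.1.2| <= 1 & `|P.2| <= 1]].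

(** The Fourier transform of the kernel vanishes off the cube of side 2, and the
region is closed. *)
Lemma fun_support_packet : fun_support (fourier4 (packet eta r n xi0)) `<=` packet_region.
Proof.
have cl : closed packet_region.
  have E : packet_region = [set X | `|(packet_freq eta r n xi0 X).1.1.1| <= 1] `&`
    [set X | `|(packet_freq eta r n xi0 X).1.1.2| <= 1] `&`
    [set X | `|(packet_freq eta r n xi0 X).1.2| <= 1] `&`
    [set X | `|(packet_freq eta r n xi0 X).2| <= 1].
    by apply/seteqP; split=> [X [? ? ? ?]|X [[[? ?] ?] ?]].
  have en := lt0r_neq0 eta0; have rn := lt0r_neq0 r0.
  rewrite E; do 3?[apply: closedI].
  - apply: (@closed_norm_affine _ eta^-1 0 (- n.1.1 / eta) 0 ((n.1.1 * xi0.2 - xi0.1.1) / eta)) => X /=.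
    by field.
  - apply: (@closed_norm_affine _ 0 eta^-1 (- n.1.2 / eta) 0 ((n.1.2 * xi0.2 - xi0.1.2) / eta)) => X /=.
    by field.
  - by apply: (@closed_norm_affine _ 0 0 r^-1 0 (- xi0.2 / r)) => X /=; field.
  - apply: (@closed_norm_affine _ (- 2 * xi0.1.1 / eta) (- 2 * xi0.1.2 / eta) (2 * xi0.2 / eta) eta^-1
      ((- hyperbolic_form xi0 + 2 * xi0.1.1 ^+ 2 + 2 * xi0.1.2 ^+ 2 - 2 * xi0.2 ^+ 2) / eta)) => X /=.
    by rewrite /dot3/=; field.
rewrite (closure_id packet_region).1//; apply: closureS => X /= fX.
have key (z : R[i]) u : z * fejer_hat u != 0 -> `|u| <= 1 /\ z != 0.
  move=> H; split; last by apply: contraNneq H => ->; rewrite mul0r.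
  apply: contraNT H; rewrite -ltNge => /ltW /fejer_hat_eq0 ->.
  by rewrite mulr0.
move: fX; rewrite fourier4_packet/= !mulrA => /key[h1] /key[h2] /key[h3] /key[h4 _].
by split.
Qed.

End Fixed.

(** Let zeta = (eta p, eta q, 0) + r s n be the displacement from xi0. Over xi0
+ zeta, the height of the surface above its tangent plane at xi0 is the value at
zeta of the quadratic form, and it equals eta^2 (p^2 + q^2) + 2 eta r s (a p + b
q) because n = (a, b, 1) is a null vector: the term (r s)^2 drops out. So the
tube, although of length of order 1, stays within O(eta) of the surface. The
base point lies in the middle cube to keep the tube in the unit cube. *)
Lemma packet_region_sub (delta a : R) (xi0 : R3 R) :
  0 < delta -> delta <= 1 / 2 -> 0 <= a <= 1 ->
  [/\ 4^-1 <= xi0.1.1 <= 3 / 4, 4^-1 <= xi0.1.2 <= 3 / 4 & 4^-1 <= xi0.2 <= 3 / 4] ->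
  packet_region (delta / 8) 8^-1 (null_dir a) xi0 `<=`
    neighborhood delta (graph_surface hyperbolic_form).
Proof.
move=> d0 d1 /andP[a0 a1] [/andP[x1 x1'] /andP[x2 x2'] /andP[x3 x3']] X [].
set b := Num.sqrt (1 - a ^+ 2).
have b0 : 0 <= b by exact: sqrtr_ge0.
have ab : a ^+ 2 + b ^+ 2 = 1 by rewrite sqr_sqrtr; [ring|nra].
have b1 : b <= 1 by nra.
rewrite /packet_freq/= -/b.
set p := (X in `|X| <= 1 -> _); set q := (X in _ -> `|X| <= 1 -> _).
set s := (X in _ -> _ -> `|X| <= 1 -> _); set w := (X in _ -> _ -> _ -> `|X| <= 1 -> _).
have eta_gt : delta / 8 != 0 by rewrite lt0r_neq0// divr_gt0.
have E3 : X.1.2 = xi0.2 + 8^-1 * s by rewrite /s; field.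
have E2 : X.1.1.2 = xi0.1.2 + delta / 8 * q + b * (8^-1 * s) by rewrite /q /s; field; lra.
have E1 : X.1.1.1 = xi0.1.1 + delta / 8 * p + a * (8^-1 * s) by rewrite /p /s; field; lra.
have E4 : X.2 - hyperbolic_form X.1 =
   delta / 8 * w - ((delta / 8) ^+ 2 * (p ^+ 2 + q ^+ 2) + 2 * (delta / 8) * (8^-1 * s) * (a * p + b * q)).
  have -> : X.2 = hyperbolic_form xi0 + dot3 (hyperbolic_grad xi0) (X.1 - xi0) + delta / 8 * w.
    by rewrite /w; field; lra.
  rewrite /hyperbolic_form /dot3 /hyperbolic_grad/= E1 E2 E3.
  move: (p) (q) (s) (w) => p' q' s' w'.
  apply/eqP; rewrite -subr_eq0; apply/eqP.
  (* The null condition a^2 + b^2 = 1 removes the only term of size 1. *)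
  transitivity (- (8^-1 * s') ^+ 2 * (a ^+ 2 + b ^+ 2 - 1)); last by rewrite ab subrr mulr0.
  by field.
move: (p) (q) (s) (w) E1 E2 E3 E4 => {}p {}q {}s {}w E1 E2 E3 E4.
rewrite !ler_norml => /andP[p1 p2] /andP[q1 q2] /andP[s1 s2] /andP[w1 w2].
have dp1 : - (1 / 16) <= delta / 8 * p by nra.
have dp2 : delta / 8 * p <= 1 / 16 by nra.
have dq1 : - (1 / 16) <= delta / 8 * q by nra.
have dq2 : delta / 8 * q <= 1 / 16 by nra.
have as1 : - (1 / 8) <= a * (8^-1 * s) by nra.
have as2 : a * (8^-1 * s) <= 1 / 8 by nra.
have bs1 : - (1 / 8) <= b * (8^-1 * s) by nra.
have bs2 : b * (8^-1 * s) <= 1 / 8 by nra.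
exists (X.1, hyperbolic_form X.1).
  have cube (y u v : R) : 4^-1 <= y -> y <= 3 / 4 -> - (1 / 16) <= u -> u <= 1 / 16 ->
      - (1 / 8) <= v -> v <= 1 / 8 -> 0 <= y + u + v <= 1.
    by clear; move=> *; apply/andP; split; lra.
  exists X.1 => //; split; rewrite ?E1 ?E2 ?E3; try exact: cube.
  rewrite -[xi0.2]addr0; apply: cube => //; clear -s1 s2; lra.
have -> : X - (X.1, hyperbolic_form X.1) = (0, X.2 - hyperbolic_form X.1).
  by case: X {E1 E2 E3 E4} => X1 X2; congr pair; rewrite /= subrr.
rewrite /norm4 /dot4 /dot3/= !mul0r !add0r -expr2 sqrtr_sqr E4 ltr_norml.
have p3 : p ^+ 2 <= 1 by nra.
have q3 : q ^+ 2 <= 1 by nra.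
have t1 : -2 <= a * p + b * q by nra.
have t2 : a * p + b * q <= 2 by nra.
move: (a * p + b * q) t1 t2 => t t1 t2.
have u1 : -2 <= s * t by nra.
have u2 : s * t <= 2 by nra.
rewrite (_ : 2 * (delta / 8) * (8^-1 * s) * t = delta / 32 * (s * t)); last by field.
move: (s * t) u1 u2 => u u1 u2.
have v0 : 0 <= p ^+ 2 + q ^+ 2 by rewrite addr_ge0 ?sqr_ge0.
have v1 : p ^+ 2 + q ^+ 2 <= 2 by lra.
move: (p ^+ 2 + q ^+ 2) v0 v1 => v v0 v1.
have z0 : 0 <= (delta / 8) ^+ 2 * v by rewrite mulr_ge0 ?sqr_ge0.
have z1 : (delta / 8) ^+ 2 * v <= delta / 8 by nra.
move: (_ ^+ 2 * v) z0 z1 => z z0 z1.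
have w3 : - (delta / 8) <= delta / 8 * w by clear -d0 w1; nra.
have w4 : delta / 8 * w <= delta / 8 by clear -d0 w2; nra.
have u3 : - (delta / 16) <= delta / 32 * u by clear -d0 u1; nra.
have u4 : delta / 32 * u <= delta / 16 by clear -d0 u2; nra.
move: (delta / 8 * w) (delta / 32 * u) w3 w4 u3 u4 => w' u' w3 w4 u3 u4.
by clear -d0 z0 z1 w3 w4 u3 u4; apply/andP; split; lra.
Qed.

End WavePacket.

(** * The part of a wave packet in a box *)

Section Measurability.
Context {R : realType} {d : measure_display} {T : measurableType d}.
Variable mu : {measure set T -> \bar R}.
Local Notation normc := Normc.normc.

(** The integral of a nonnegative function is a supremum over simple functions,
so monotonicity holds without measurability of either function. *)
Lemma ge0_le_integralT (f g : T -> \bar R) :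
  (forall x, 0 <= f x)%E -> (forall x, f x <= g x)%E ->
  (\int[mu]_x f x <= \int[mu]_x g x)%E.
Proof.
move=> f0 fg; have g0 x : (0 <= g x)%E by exact: le_trans (fg x).
rewrite !ge0_integralTE//; apply: ereal_sup_le => _ [h hf <-]; exists h => //= x.
exact: le_trans (fg x).
Qed.

Lemma cintegrable_unimodular (F phase : T -> R[i]) :
  cintegrable mu F -> cmeas phase -> (forall x, normc (phase x) = 1) ->
  cintegrable mu (fun x => F x * phase x).
Proof.
move=> /cintegrableP[cF Fi] cp p1; apply/cintegrableP; split; first exact: cmeasM.
by under eq_integral do rewrite Normc.normcM p1 mulr1.
Qed.

End Measurability.

Section CmeasCintegral.
Context {R : realType} {d1 d2 : measure_display}.
Context {X : measurableType d1} {Y : measurableType d2}.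
Variable mu : {sigma_finite_measure set X -> \bar R}.
Variable nu : {sigma_finite_measure set Y -> \bar R}.

(** Measurability of the partial integrals, from Fubini. *)
Lemma cmeas_cintegral2 (F : X * Y -> R[i]) : cintegrable (mu \x nu)%E F ->
  cmeas (fun y => cintegral mu (fun x => F (x, y))).
Proof.
move=> [F1 F2]; split; rewrite /cintegral /Rintegral/=.
  by apply: measurableT_comp => //; exact: measurable_fubini_G F1.
by apply: measurableT_comp => //; exact: measurable_fubini_G F2.
Qed.

End CmeasCintegral.

Section BoxPart.
Context {R : realType}.
Local Notation mR := (measurableTypeR R).
Local Notation mR3 := (mR * mR * mR)%type.
Local Notation mR4 := (mR * mR * mR * mR)%type.
Local Notation normc := Normc.normc.

Lemma measurable_tube_adj (eta r : R) n : measurable_fun setT (tube_adj eta r n : mR3 -> mR3).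
Proof.
apply: measurable_fun_pair; first apply: measurable_fun_pair; apply: measurable_funM => //.
- by repeat apply: measurableT_comp => //.
- by repeat apply: measurableT_comp => //.
- apply: measurable_funD => //; apply: measurable_funD; apply: measurable_funM => //;
  by repeat apply: measurableT_comp => //.
Qed.

Lemma measurable_addr3 : measurable_fun setT (fun z : mR3 * mR3 => z.1 + z.2 : mR3).
Proof.
by apply: measurable_fun_pair; first apply: measurable_fun_pair; apply: measurable_funD;
  repeat apply: measurableT_comp => //.
Qed.

Lemma measurable_oppr3 : measurable_fun setT (fun z : mR3 => - z : mR3).
Proof.
by apply: measurable_fun_pair; first apply: measurable_fun_pair; apply: measurableT_comp => //;
  repeat apply: measurableT_comp => //.
Qed.

Lemma measurable_dot3_pair : measurable_fun setT (fun z : mR3 * mR3 => dot3 z.1 z.2 : mR).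
Proof.
by rewrite /dot3; do 2?[apply: measurable_funD]; apply: measurable_funM;
  repeat apply: measurableT_comp => //.
Qed.

Lemma measurable_tube_map (eta r : R) n : measurable_fun setT (tube_map eta r n : mR3 -> mR3).
Proof.
rewrite /tube_map; apply: measurable_fun_pair; first apply: measurable_fun_pair; apply: measurable_funD => //=;
 apply: measurable_funM => //; do ?apply: measurable_funM => //; by repeat apply: measurableT_comp => //.
Qed.

Lemma measurable_translate (c : R3 R) : measurable_fun setT (fun x : mR3 => c + x : mR3).
Proof.
have [_ m _] := scales_leb3_translation c.
by under eq_fun do rewrite addrC.
Qed.

Definition tube_trace (eta r : R) (n xi0 : R3 R) (B : set (R3 R)) : set (R3 R) :=
  [set z | cube3 z /\ B (xi0 + tube_map eta r n z)].

Lemma measurable_tube_trace (eta r : R) n xi0 (B : set mR3) : measurable B ->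
  measurable (tube_trace eta r n xi0 B : set mR3).
Proof.
move=> mB; apply: measurableI; first exact: measurable_cube3.
have m : measurable_fun setT (fun z : mR3 => xi0 + tube_map eta r n z : mR3).
  exact: (measurableT_comp (measurable_translate xi0) (measurable_tube_map eta r n)).
by rewrite -[X in measurable X]setTI; exact: m.
Qed.

Lemma leb3_tube_trace_le8 (eta r : R) n xi0 (B : set mR3) : measurable B ->
  (leb3 (tube_trace eta r n xi0 B) <= 8%:E)%E.
Proof.
move=> mB; rewrite -leb3_cube3; apply: le_measure; rewrite ?inE.
- exact: measurable_tube_trace.
- exact: measurable_cube3.
- by move=> z [].
Qed.

Definition trace_mass (eta r : R) (n xi0 : R3 R) (B : set (R3 R)) : R :=
  fine (leb3 (tube_trace eta r n xi0 B : set mR3)).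

Lemma leb3_tube_traceE (eta r : R) n xi0 (B : set mR3) : measurable B ->
  leb3 (tube_trace eta r n xi0 B : set mR3) = (trace_mass eta r n xi0 B)%:E.
Proof.
move=> mB; rewrite /trace_mass fineK// ge0_fin_numE ?measure_ge0//.
by apply: le_lt_trans (leb3_tube_trace_le8 eta r n xi0 mB) _; rewrite ltry.
Qed.

Lemma tri3_ge0 (z : mR3) : 0 <= tri3 z. Proof. by rewrite /tri3 !mulr_ge0 ?tri_ge0. Qed.

Lemma tri3_le1 (z : mR3) : tri3 z <= 1.
Proof. by rewrite /tri3 mulr_ile1 ?mulr_ge0 ?tri_ge0 ?tri_le1// mulr_ile1 ?tri_ge0 ?tri_le1. Qed.

Lemma tri3_eq0 (z : mR3) : ~ cube3 z -> tri3 z = 0.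
Proof.
rewrite /tri3 => nz; apply/eqP; rewrite !mulf_eq0; apply: contra_notT nz.
rewrite !negb_or => /andP[/andP[h1 h2] h3]; rewrite /cube3/=.
have key t : tri t != 0 -> t \in `[(-1)%R, 1%R].
  by apply: contraNT => /tri_eq0 ->.
by do !split; exact: key.
Qed.

Variables (eta r : R) (n xi0 : R3 R).
Hypotheses (eta0 : 0 < eta) (r0 : 0 < r) (n2 : n.2 = 1).
Variables (Xi : set (R3 R) -> R3 R -> R[i]) (S : set (R3 R)) (B : set mR3).
Hypotheses (mB : measurable B) (XiI : cintegrable leb3 (Xi S))
  (XiB : forall xi, fourier3 (Xi S) xi != 0 -> B xi)
  (Xi01 : forall xi, 0 <= fourier3 (Xi S) xi <= 1).

Let f := packet eta r n xi0.
Let M : R := trace_mass eta r n xi0 B.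

Lemma packet_shift x y : f (x.1 - y, x.2) =
  (fejer3 (tube_adj eta r n (x.1 + x.2 *: hyperbolic_grad xi0 - y)))%:C *
  ((fejer (eta * x.2))%:C * expi (packet_phase xi0 (x.1 - y, x.2))).
Proof.
rewrite /f /packet /packet_map /fejer4/= rmorphM/= -mulrA.
by rewrite [X in fejer3 (tube_adj _ _ _ X)](_ : _ = x.1 + x.2 *: hyperbolic_grad xi0 - y)// addrAC.
Qed.

Let u x : R3 R := x.1 + x.2 *: hyperbolic_grad xi0.
Let amp (x : R4 R) (y : mR3) : R[i] :=
  Xi S y * ((fejer (eta * x.2))%:C * expi (packet_phase xi0 (x.1 - y, x.2))).
Let G (x : R4 R) (yz : mR3 * mR3) : R[i] :=
  amp x yz.1 * (tri3 yz.2)%:C * expi (2 * pi * dot3 (tube_adj eta r n (u x - yz.1)) yz.2).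

Let cintegrable_tri3_real : cintegrable leb3 (fun z : mR3 => (tri3 z)%:C).
Proof.
have := cintegrable_tri3 (0 : R3 R); congr cintegrable; apply/funext => z.
by rewrite /dot3/= !mul0r !addr0 mulr0 expi0 mulr1.
Qed.

Let cintegrable_amp x : cintegrable leb3 (amp x).
Proof.
have := cintegrableZl (fejer (eta * x.2))%:C XiI.
have cp : cmeas (fun y : mR3 => expi (packet_phase xi0 (x.1 - y, x.2))).
  apply: cmeas_expi; apply: (measurableT_comp (measurable_packet_phase xi0)).
  apply: measurable_fun_pair => //.
  exact: (measurableT_comp (measurable_translate x.1) measurable_oppr3).
move=> /cintegrable_unimodular/(_ cp (fun y => normc_expi _)).
by congr cintegrable; apply/funext => y; rewrite /amp mulrCA mulrA.
Qed.

Let cintegrable_G x : cintegrable (sleb3 \x sleb3)%E (G x).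
Proof.
apply: cintegrable_unimodular.
- exact: (@cintegrable_prodM R _ _ _ _ sleb3 sleb3 (amp x) (fun z => (tri3 z)%:C)).
- apply: cmeas_expi; apply: measurable_funM => //.
  apply: (measurableT_comp measurable_dot3_pair (g := fun yz : mR3 * mR3 => (tube_adj eta r n (u x - yz.1), yz.2))).
  apply: measurable_fun_pair => //.
  apply: (measurableT_comp (measurable_tube_adj eta r n)).
  apply: (measurableT_comp (measurable_translate (u x))).
  exact: (measurableT_comp measurable_oppr3).
- by move=> yz; exact: normc_expi.
Qed.

(** Writing the spatial kernel of the packet as a superposition of the
characters with frequencies in the tube and exchanging the integrals. *)
Lemma box_part_swap x : box_part Xi f S x =
  cintegral leb3 (fun z : mR3 => cintegral leb3 (fun y : mR3 => G x (y, z))).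
Proof.
rewrite !leb3E (cintegral_prod2 (cintegrable_G x)) -(cintegral_prod1 (cintegrable_G x)).
rewrite /box_part; congr cintegral; apply/funext => y.
rewrite packet_shift -cintegral_tri3 -mulrA mulrC.
rewrite -cintegralZl; last exact: cintegrable_tri3.
by congr cintegral; apply/funext => z; rewrite /G /amp/=; ring.
Qed.

(** The inner integral is the Fourier transform of the multiplier at the
frequency with parameter z of the tube: this is where the support of the
multiplier enters. *)
Lemma G_fourier x z : cintegral leb3 (fun y : mR3 => G x (y, z)) =
  (tri3 z)%:C * (fejer (eta * x.2))%:C *
  expi (packet_phase xi0 x + 2 * pi * dot3 (u x) (tube_map eta r n z)) *
  fourier3 (Xi S) (xi0 + tube_map eta r n z).
Proof.
rewrite /fourier3 -cintegralZl; last first.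
  apply: cintegrable_unimodular => //; last by move=> y; exact: normc_expi.
  apply: cmeas_expi; apply: measurableT_comp => //; apply: measurable_funM => //.
  exact: measurable_dot3.
congr cintegral; apply/funext => y.
rewrite /G /amp/= -dot3_tube_map//.
have -> : 2 * pi * dot3 (u x - y) (tube_map eta r n z) =
   2 * pi * dot3 (u x) (tube_map eta r n z) + - (2 * pi * dot3 y (tube_map eta r n z)).
  by rewrite dot3D dot3N; ring.
have -> : packet_phase xi0 (x.1 - y, x.2) = packet_phase xi0 x + - (2 * pi * dot3 y xi0).
  by rewrite /packet_phase/= dot3D dot3N; ring.
have -> : - (2 * pi * dot3 y (xi0 + tube_map eta r n z)) =
   - (2 * pi * dot3 y xi0) + - (2 * pi * dot3 y (tube_map eta r n z)).
  by rewrite dot3Dr; ring.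
by rewrite !expiD; ring.
Qed.

Lemma normc_fourier_le1 xi : normc (fourier3 (Xi S) xi) <= 1.
Proof.
have := Xi01 xi; case: (fourier3 _ _) => a b; rewrite !lecE/= => /andP[/andP[/eqP b0 a0] /andP[_ a1]].
by rewrite b0 expr0n addr0 sqrtr_sqr ger0_norm.
Qed.

(** By box_part_swap and G_fourier, the box part is an integral over the
parameters z of a function bounded by 1 that vanishes where the multiplier does,
that is, off the trace of the doubled box. *)
Lemma normc_box_part_le x : normc (box_part Xi f S x) <= 2 * M.
Proof.
rewrite -lee_fin box_part_swap.
apply: (le_trans (normc_cintegral_le leb3 (cmeas_cintegral2 (cintegrable_G x)))).
have mT : measurable (tube_trace eta r n xi0 B : set mR3) by exact: measurable_tube_trace.
have IE : (\int[leb3]_z (\1_(tube_trace eta r n xi0 B) z)%:E = M%:E)%E.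
  by rewrite integral_indic//= setIT leb3_tube_traceE.
rewrite EFinM lee_pmul2l ?lte_fin// -IE.
apply: ge0_le_integralT => z; first by rewrite lee_fin normc_ge0.
rewrite lee_fin G_fourier !Normc.normcM normc_expi mulr1 !normc_real !ger0_norm ?fejer_ge0 ?tri3_ge0//.
rewrite indicE; have [zT|zT] := boolP (z \in tube_trace eta r n xi0 B).
  have tf : tri3 z * fejer (eta * x.2) <= 1.
    by rewrite mulr_ile1 ?tri3_ge0 ?fejer_ge0 ?tri3_le1 ?fejer_le1.
  apply: mulr_ile1 => //; last exact: normc_fourier_le1.
    by rewrite mulr_ge0 ?tri3_ge0 ?fejer_ge0.
  exact: normc_ge0.
have [cz|/tri3_eq0 ->] := pselect (cube3 z); last by rewrite !mul0r.
have -> : fourier3 (Xi S) (xi0 + tube_map eta r n z) = 0.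
  apply/eqP; apply: contraNT zT => /XiB Bz; by rewrite inE.
by rewrite Normc.normc0 mulr0.
Qed.

Lemma trace_mass_ge0 : 0 <= M. Proof. exact: fine_ge0. Qed.

Let cmeas_Xi : cmeas (Xi S : mR3 -> R[i]). Proof. exact: cintegrable_cmeas XiI. Qed.

Let env (x : mR4) (y : mR3) : \bar R := (normc (f (x.1 - y, x.2)) * normc (Xi S y))%:E.

Let measurable_env : measurable_fun setT (fun xy : mR4 * mR3 => env xy.1 xy.2).
Proof.
apply/measurable_EFinP; apply: measurable_funM.
  apply: (measurableT_comp (measurable_normc (cmeas_packet n xi0 eta0 r0)) (g := fun xy : mR4 * mR3 => (xy.1.1 - xy.2, xy.1.2))).
  apply: measurable_fun_pair; last by repeat apply: measurableT_comp => //.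
  apply: (measurableT_comp measurable_addr3 (g := fun xy : mR4 * mR3 => (xy.1.1, - xy.2))).
  apply: measurable_fun_pair; first by repeat apply: measurableT_comp => //.
  exact: (measurableT_comp measurable_oppr3).
exact: (measurableT_comp (measurable_normc cmeas_Xi)).
Qed.

Lemma cmeas_packet_slice x : cmeas (fun y : mR3 => f (x.1 - y, x.2) * Xi S y).
Proof.
apply: cmeasM => //.
have m : measurable_fun setT (fun y : mR3 => (x.1 - y, x.2) : mR4).
  apply: measurable_fun_pair => //.
  exact: (measurableT_comp (measurable_translate x.1) measurable_oppr3).
by have [h1 h2] := cmeas_packet n xi0 eta0 r0; split; [exact: (measurableT_comp h1 m)|exact: (measurableT_comp h2 m)].
Qed.

Lemma normc_box_part_env x :
  ((normc (box_part Xi f S x))%:E <= 2%:E * \int[leb3]_y env x y)%E.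
Proof.
apply: (le_trans (normc_cintegral_le leb3 (cmeas_packet_slice x))).
by under eq_integral do rewrite Normc.normcM.
Qed.

(** The identity behind Young's inequality in L^1, from Tonelli and translation
invariance. *)
Lemma integral_env :
  (\int[leb4]_x \int[leb3]_y env x y =
   (packet_scale eta r * fejer_pmass 1 ^+ 4)%:E * \int[leb3]_y (normc (Xi S y))%:E)%E.
Proof.
have mf := measurable_normc (cmeas_packet n xi0 eta0 r0).
have mX := measurable_normc cmeas_Xi.
rewrite leb3E leb4E (@fubini_tonelli _ _ mR4 mR3 R (prod_sigma_finite sleb3 sleb) sleb3 (fun xy => env xy.1 xy.2))//; last first.
  by move=> xy; rewrite lee_fin mulr_ge0 ?normc_ge0.
rewrite /= /fubini_G/=.
have E y : (\int[prod_sigma_finite sleb3 sleb]_x env x y =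
   (packet_scale eta r * fejer_pmass 1 ^+ 4)%:E * (normc (Xi S y))%:E)%E.
  rewrite /env; under eq_integral do rewrite EFinM.
  have mfy : measurable_fun setT (fun x : mR4 => (normc (f (x.1 - y, x.2)))%:E).
    apply/measurable_EFinP; have [_ m _] := scales_leb4_translation (- y).
    exact: (measurableT_comp mf m).
  rewrite ge0_integralZr//; last 2 first.
  - by move=> x _; rewrite lee_fin normc_ge0.
  - by rewrite lee_fin normc_ge0.
  congr (_ * _)%E; rewrite -(integral_normc_packet n xi0 eta0 r0).
  have := scales_ge0_integral (scales_leb4_translation (- y)) (f := fun x : mR4 => (normc (f x))%:E).
  rewrite mul1e => <- //; first exact/measurable_EFinP.
  by move=> x; rewrite lee_fin normc_ge0.
under eq_integral do rewrite E.
rewrite ge0_integralZl_EFin//.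
- by move=> y _; rewrite lee_fin normc_ge0.
- exact/measurable_EFinP.
- by rewrite mulr_ge0 ?(ltW (packet_scale_gt0 _ _))// exprn_ge0// ltW// fejer_pmass_gt0.
Qed.

Variable c : R.
Hypotheses (c0 : 0 <= c) (Xic : (cLnorm leb3 1 (Xi S) <= c%:E)%E).

(** Interpolation between the sup norm and L^1: the integrand |f_S|^p is at most
(2 M)^(p - 1) |f_S|, and the integral of |f_S| is controlled by integral_env. *)
Lemma box_part_Lp (p : R) : 1 <= p ->
  (cLnorm leb4 p (box_part Xi f S) <=
   (((2 * M) `^ (p - 1) * (2 * c * (packet_scale eta r * fejer_pmass 1 ^+ 4))) `^ (p^-1))%:E)%E.
Proof.
move=> p1; have p0 : 0 < p by lra.
have m1 : 0 <= fejer_pmass (1:R) by rewrite ltW// fejer_pmass_gt0.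
have K0 : 0 <= packet_scale eta r * fejer_pmass 1 ^+ 4.
  by rewrite mulr_ge0 ?(ltW (packet_scale_gt0 _ _))// exprn_ge0.
have := integral_env; move: (packet_scale eta r * _) K0 => K K0 KE.
have L0 : 0 <= (2 * M) `^ (p - 1) * (2 * c * K).
  by rewrite mulr_ge0 ?powR_ge0// mulr_ge0// mulr_ge0.
rewrite /cLnorm unlock -poweR_EFin; apply: gt0_ler_poweR; first by rewrite invr_ge0 ltW.
- rewrite in_itv/= leey andbT; apply: integral_ge0 => x _.
  by rewrite lee_fin powR_ge0.
- by rewrite in_itv /Order.le; apply/andP; split; [exact: L0|exact: leey].
apply: (@le_trans _ _ (\int[leb4]_x (((2 * M) `^ (p - 1))%:E * (2%:E * \int[leb3]_y env x y)))%E).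
  apply: ge0_le_integralT => x; first exact: poweR_ge0.
  rewrite gee0_abs ?lee_fin ?normc_ge0// poweR_EFin -mulr_powRB1 ?normc_ge0//.
  rewrite mulrC EFinM; apply: lee_pmul; rewrite ?lee_fin ?powR_ge0 ?normc_ge0//.
    rewrite ge0_ler_powR ?nnegrE ?normc_ge0 ?normc_box_part_le ?mulr_ge0 ?trace_mass_ge0//; lra.
  exact: normc_box_part_env.
have menv : measurable_fun setT (fun x : mR4 => \int[leb3]_y env x y)%E.
  rewrite leb3E; apply: (@measurable_fun_fubini_tonelli_F _ _ mR4 mR3 R sleb3 (fun xy => env xy.1 xy.2)) => //.
  by move=> xy; rewrite lee_fin mulr_ge0 ?normc_ge0.
have env0 x : (0 <= \int[leb3]_y env x y)%E.
  by apply: integral_ge0 => y _; rewrite lee_fin mulr_ge0 ?normc_ge0.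
rewrite ge0_integralZl_EFin ?powR_ge0//; last 2 first.
- by move=> x _; rewrite mule_ge0.
- exact: measurable_funeM.
rewrite ge0_integralZl_EFin// KE EFinM lee_wpmul2l ?lee_fin ?powR_ge0//.
have -> : (2 * c * K)%:E =
  (2%:E * (K%:E * c%:E))%E.
  by rewrite -!EFinM; congr EFin; ring.
rewrite lee_wpmul2l ?lee_fin// lee_wpmul2l ?lee_fin//.
move: Xic; rewrite /cLnorm Lnorm1.
by under eq_integral do rewrite gee0_abs ?lee_fin ?normc_ge0//.
Qed.

End BoxPart.

(** * Boxes, flatness and null directions *)

Section Boxes.
Context {R : realType}.
Local Notation mR := (measurableTypeR R).
Local Notation mR3 := (mR * mR * mR)%type.

Lemma R3P (x y : R3 R) : x.1.1 = y.1.1 -> x.1.2 = y.1.2 -> x.2 = y.2 -> x = y.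
Proof. by case: x y => [[x1 x2] x3] [[y1 y2] y3] /= -> -> ->. Qed.

Lemma dot3_sumr (t : 'I_3 -> R) (u : 'I_3 -> R3 R) (y : R3 R) :
  dot3 (\sum_(i < 3) t i *: u i) y = \sum_(i < 3) t i * dot3 (u i) y.
Proof. by rewrite !big_ord_recl !big_ord0 /dot3/= /GRing.scale/=; ring. Qed.

(** An orthonormal triple is a basis: the square matrix of its coordinates has
its transpose as a left inverse, hence as a right inverse too. *)
Lemma orthonormal3_sum (u : 'I_3 -> R3 R) (x : R3 R) : orthonormal3 u ->
  x = \sum_(i < 3) dot3 x (u i) *: u i.
Proof.
move=> ou.
pose co (y : R3 R) (k : 'I_3) : R := if k == 0 then y.1.1 else if k == 1 then y.1.2 else y.2.
pose U : 'M[R]_3 := \matrix_(i, k) co (u i) k.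
have dotE y z : dot3 y z = \sum_k co y k * co z k.
  by rewrite !big_ord_recl big_ord0 /co/= /dot3; ring.
have /mulmx1C UU : U *m U^T = 1%:M.
  apply/matrixP => i j; rewrite !mxE -ou dotE; apply: eq_bigr => k _.
  by rewrite !mxE.
have E k : co x k = \sum_i dot3 x (u i) * co (u i) k.
  transitivity (\sum_i \sum_k' co x k' * (co (u i) k' * co (u i) k)); last first.
    apply: eq_bigr => i _; rewrite dotE mulr_suml; apply: eq_bigr => k' _.
    by rewrite mulrA.
  rewrite exchange_big/= (bigD1 k)//= [X in _ + X]big1 ?addr0.
    rewrite -mulr_sumr; have /matrixP/(_ k k) := UU; rewrite !mxE eqxx.
    under eq_bigr do rewrite !mxE.
    by move=> ->; rewrite mulr1.
  move=> k' kk'; rewrite -mulr_sumr.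
  have /matrixP/(_ k' k) := UU; rewrite !mxE (negbTE kk').
  under eq_bigr do rewrite !mxE.
  by move=> ->; rewrite mulr0.
have h0 := E 0; have h1 := E 1; have h2 := E 2%:R; rewrite /co/= in h0 h1 h2.
apply: (@eq_trans _ _ (x.1.1, x.1.2, x.2)); first by case: (x) => -[].
move: h0 h1 h2; rewrite !big_ord_recl !big_ord0 /= => h0 h1 h2.
by congr (_, _, _); [exact: h0|exact: h1|exact: h2].
Qed.

(** Membership in a box in terms of inner products, which makes measurability
and dilation evident. *)
Lemma in_boxE (c : R3 R) (u : 'I_3 -> R3 R) (l : 'I_3 -> R) x : orthonormal3 u ->
  box c u l x <-> forall i, `|dot3 (x - c) (u i)| <= l i.
Proof.
move=> ou; split=> [[t tl <-] i|H].
  rewrite addrC addKr dot3_sumr (bigD1 i)//= big1 ?addr0.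
    by rewrite ou eqxx mulr1; exact: tl.
  by move=> j ji; rewrite ou (negbTE ji) mulr0.
exists (fun i => dot3 (x - c) (u i)) => //.
by rewrite -(orthonormal3_sum (x - c) ou) subrKC.
Qed.

Lemma measurable_box c u l : orthonormal3 u -> measurable (box c u l : set mR3).
Proof.
move=> ou.
have -> : (box c u l : set mR3) = \bigcap_(i in [set: 'I_3])
    ((fun x : mR3 => dot3 (x - c) (u i) : mR) @^-1` `[- l i, l i]%classic).
  apply/seteqP; split=> x.
    move=> /(in_boxE _ _ _ ou) H i _ /=; by rewrite in_itv/= -ler_norml.
  move=> H; apply/(in_boxE _ _ _ ou) => i.
  by have := H i I; rewrite /= in_itv/= -ler_norml.
apply: fin_bigcap_measurable => // i _; rewrite -[X in measurable X]setTI.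
have m : measurable_fun setT (fun x : mR3 => dot3 (x - c) (u i) : mR).
  have [_ mc _] := scales_leb3_translation (- c).
  exact: (measurableT_comp (measurable_dot3 (u i)) mc).
by apply: m => //; exact: measurable_itv.
Qed.

Lemma leb3_box_double (c : R3 R) (u : 'I_3 -> R3 R) (l : 'I_3 -> R) : orthonormal3 u ->
  leb3 (box c u (fun i => 2 * l i)) = (8%:E * leb3 (box c u l))%E.
Proof.
move=> ou.
have [_ _ /(_ (box c u (fun i => 2 * l i)) (measurable_box _ _ ou))] := scales_leb3_dilation (- c) (ltr0Sn R 1).
have -> : (fun x : R3 R => 2 *: x - c) @^-1` box c u (fun i => 2 * l i) = box c u l.
  apply/seteqP; split=> x; rewrite /preimage/= !(in_boxE _ _ _ ou) => H i; have := H i.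
    rewrite (_ : 2 *: x - c - c = 2 *: (x - c)); last by apply: R3P; rewrite /= /GRing.scale/=; ring.
    by rewrite dot3Z normrM ger0_norm// ler_pM2l.
  rewrite (_ : 2 *: x - c - c = 2 *: (x - c)); last by apply: R3P; rewrite /= /GRing.scale/=; ring.
  by rewrite dot3Z normrM ger0_norm// ler_pM2l.
move=> ->; rewrite muleA -EFinM (_ : 8 * (2 ^+ 3)^-1 = 1) ?mul1e//; by field.
Qed.

(** A box contains a small axis-parallel cube, the image of cube3 by a dilation. *)
Lemma leb3_box_gt0 (c : R3 R) (u : 'I_3 -> R3 R) (l : 'I_3 -> R) : orthonormal3 u -> (forall i, 0 < l i) ->
  (0 < leb3 (box c u l))%E.
Proof.
move=> ou l0; pose m := Num.min (l 0) (Num.min (l 1) (l 2%:R)).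
have m0 : 0 < m by rewrite !lt_min !l0.
have ml i : m <= l i.
  have : i = 0 \/ i = 1 \/ i = 2%:R :> 'I_3.
    by case: i => [[|[|[|//]]]] Hi; [left|right; left|right; right]; apply/val_inj.
  by move=> [->|[->|->]]; rewrite /m !ge_min lexx ?orbT.
have k0 : 0 < 3 / m by rewrite divr_gt0.
have [_ _ /(_ (cube3 : set mR3) measurable_cube3)] := scales_leb3_dilation (- ((3 / m) *: c)) k0.
rewrite leb3_cube3 => E.
apply: (@lt_le_trans _ _ (leb3 ((fun x : R3 R => (3 / m) *: x - (3 / m) *: c) @^-1` cube3))).
  by rewrite E -EFinM lte_fin mulr_gt0// invr_gt0 exprn_gt0.
have [_ mphi _] := scales_leb3_dilation (- ((3 / m) *: c)) k0.
apply: le_measure; rewrite ?inE.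
- by rewrite -[X in measurable X]setTI; apply: mphi => //; exact: measurable_cube3.
- exact: measurable_box.
move=> x; rewrite /preimage/= -scalerBr => -[[]]; rewrite /= !in_itv/= -!ler_norml => h1 h2 h3.
apply/(in_boxE _ _ _ ou) => i; apply: le_trans (ml i).
have u1 : (u i).1.1 * (u i).1.1 + (u i).1.2 * (u i).1.2 + (u i).2 * (u i).2 = 1.
  by have := ou i i; rewrite eqxx /dot3.
move: h1 h2 h3.
have key (y : R) : `|(3 / m) *: y| <= 1 -> `|y| <= m / 3.
  rewrite (_ : (3 / m) *: y = (3 / m) * y)// normrM (gtr0_norm k0).
  by move=> H; rewrite -(ler_pM2l k0) (le_trans H)// (_ : 3 / m * (m / 3) = 1)//; field; rewrite lt0r_neq0.
move=> /key h1 /key h2 /key h3; rewrite /dot3.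
have un (a b d : R) : a * a + b * b + d * d = 1 -> `|a| <= 1.
  by move=> H; rewrite -[leRHS]normr1 -ler_sqr ?nnegrE// !real_normK ?num_real//; nra.
have v1 : `|(u i).1.1| <= 1 by apply: (un _ _ _ u1).
have v2 : `|(u i).1.2| <= 1 by apply: (un _ (u i).1.1 (u i).2); rewrite -u1; ring.
have v3 : `|(u i).2| <= 1 by apply: (un _ (u i).1.1 (u i).1.2); rewrite -u1; ring.
apply: le_trans (ler_normD _ _) _; rewrite (_ : m = m / 3 * 1 + m / 3 * 1 + m / 3 * 1); last by field.
apply: lerD; last by rewrite normrM ler_pM.
by apply: le_trans (ler_normD _ _) _; apply: lerD; rewrite normrM ler_pM.
Qed.

(** The derivative of a function that is quadratic along the line, read off its
exact expansion. *)
Lemma derive_quadratic (phi : R3 R -> R) (a v : R3 R) (B C : R) :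
  (forall h : R, phi (h *: v + a) - phi a = h * B + h ^+ 2 * C) -> 'D_v phi a = B.
Proof.
move=> H; rewrite /derive; apply: cvg_lim => //.
have cB : (fun h : R => B + h * C) @ 0^' --> B.
  rewrite -[X in _ --> X]addr0 -[X in _ --> _ + X](mul0r C).
  apply: cvgD; first exact: cvg_cst.
  apply: cvgM; last exact: cvg_cst.
  exact: cvg_within_filter.
apply: cvg_trans cB; apply: near_eq_cvg; near=> h.
have h0 : h != 0 by near: h; exact: nbhs_dnbhs_neq.
rewrite /= /shift/= H /GRing.scale/=; field.
by rewrite h0.
Unshelve. all: by end_near. Qed.

Lemma gradient_hyperbolic (u : R3 R) : gradient3 hyperbolic_form u = hyperbolic_grad u.
Proof.
rewrite /gradient3 /hyperbolic_grad; congr (_, _, _).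
- by apply: (derive_quadratic (C := 1)) => h; rewrite /hyperbolic_form/= /GRing.scale/=; ring.
- by apply: (derive_quadratic (C := 1)) => h; rewrite /hyperbolic_form/= /GRing.scale/=; ring.
- by apply: (derive_quadratic (C := -1)) => h; rewrite /hyperbolic_form/= /GRing.scale/=; ring.
Qed.

(** The second order Taylor expansion of a quadratic form is exact: the quantity
in the definition of flatness is the form evaluated at u - v, up to sign. *)
Lemma flat_hyperbolic (eps : R) (S : set (R3 R)) u v :
  flat hyperbolic_form eps S -> S u -> S v -> `|hyperbolic_form (u - v)| <= eps.
Proof.
move=> fS Su Sv; rewrite -lee_fin; apply: le_trans fS.
apply: ereal_sup_ubound; exists u => //; exists v => //; congr EFin.
rewrite gradient_hyperbolic -normrN; congr (`|_|).
by rewrite /hyperbolic_form /dot3/=; ring.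
Qed.

(** Every vector d of twice the size of the box is the difference of the points
c + d / 2 and c - d / 2 of the box. *)
Lemma flat_box (eps : R) c u (l : 'I_3 -> R) d : orthonormal3 u ->
  flat hyperbolic_form eps (box c u l) -> (forall i, `|dot3 d (u i)| <= 2 * l i) ->
  `|hyperbolic_form d| <= eps.
Proof.
move=> ou fS dl.
have half s : `|s| = 1 -> box c u l (c + (s / 2) *: d).
  move=> s1; apply/(in_boxE _ _ _ ou) => i.
  rewrite [c + _]addrC addrK dot3Z normrM normf_div s1 [ `|2| ]ger0_norm//.
  by have := dl i; move: (`|_|) (l i) => y k; lra.
have := flat_hyperbolic fS (half 1 (normr1 _)) (half (-1) (normrN1 _)).
congr (`|hyperbolic_form _| <= _).
rewrite opprD addrACA subrr add0r -scalerBl.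
by rewrite (_ : 1 / 2 - -1 / 2 = 1) ?scale1r//; field.
Qed.

Definition hyperbolic_bilinear (x y : R3 R) : R :=
  x.1.1 * y.1.1 + x.1.2 * y.1.2 - x.2 * y.2.

(** Differences of points of the doubled box have up to four times the size of
the box. Scaled by 1/2 (and their sum by 1/4) they come under flat_box, and 12
is the sum of the coefficients 8, 2 and 2 of the polarization identity. *)
Lemma flat_polarization (eps : R) c u (l : 'I_3 -> R) x y x' y' : orthonormal3 u ->
  flat hyperbolic_form eps (box c u l) ->
  let B := box c u (fun i => 2 * l i) in
  B x -> B y -> B x' -> B y' ->
  `|hyperbolic_bilinear (x - y) (x' - y')| <= 12 * eps.
Proof.
move=> ou fS B Bx By Bx' By'.
have diff (a b : R3 R) : B a -> B b -> forall i, `|dot3 (a - b) (u i)| <= 4 * l i.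
  move=> /(in_boxE _ _ _ ou) Ha /(in_boxE _ _ _ ou) Hb i.
  rewrite (_ : a - b = (a - c) - (b - c)); last by rewrite opprB addrA subrK.
  rewrite dot3D dot3N; apply: le_trans (ler_normB _ _) _.
  by have := Ha i; have := Hb i; lra.
have d1 := diff _ _ Bx By; have d2 := diff _ _ Bx' By'.
move: (x - y) (x' - y') d1 d2 => d d' d1 d2.
have q1 : `|hyperbolic_form (2^-1 *: d)| <= eps.
  apply: (flat_box ou fS) => i; rewrite dot3Z normrM ger0_norm//; have := d1 i; lra.
have q2 : `|hyperbolic_form (2^-1 *: d')| <= eps.
  apply: (flat_box ou fS) => i; rewrite dot3Z normrM ger0_norm//; have := d2 i; lra.
have q3 : `|hyperbolic_form (4^-1 *: (d + d'))| <= eps.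
  apply: (flat_box ou fS) => i; rewrite dot3Z dot3D normrM ger0_norm//.
  have := ler_normD (dot3 d (u i)) (dot3 d' (u i)); have := d1 i; have := d2 i.
  move: (`|_ + _|) (`|_|) (`|_|) (l i) => a1 a2 a3 li; lra.
have E : hyperbolic_bilinear d d' = 8 * hyperbolic_form (4^-1 *: (d + d'))
    - 2 * hyperbolic_form (2^-1 *: d) - 2 * hyperbolic_form (2^-1 *: d').
  by rewrite /hyperbolic_bilinear /hyperbolic_form/= /GRing.scale/=; field.
rewrite E; move: q1 q2 q3; rewrite !ler_norml.
move: (hyperbolic_form _) (hyperbolic_form _) (hyperbolic_form _) => a1 a2 a3.
by move=> /andP[? ?] /andP[? ?] /andP[? ?]; apply/andP; split; lra.
Qed.

(** For the unit vectors (a, b) and (a', b') the bilinear form equals their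
inner product minus 1, that is, minus half their squared distance. *)
Lemma null_dir_bilinear (a a' : R) : 0 <= a <= 1 -> 0 <= a' <= 1 ->
  (a - a') ^+ 2 / 2 <= - hyperbolic_bilinear (null_dir a) (null_dir a').
Proof.
move=> /andP[a0 a1] /andP[b0 b1]; rewrite /hyperbolic_bilinear/=.
set b := Num.sqrt _; set b' := Num.sqrt _.
have ab : a ^+ 2 + b ^+ 2 = 1 by rewrite sqr_sqrtr; [ring|nra].
have ab' : a' ^+ 2 + b' ^+ 2 = 1 by rewrite sqr_sqrtr; [ring|nra].
have := sqr_ge0 (b - b'); move: b b' ab ab' => b b' ab ab' H; nra.
Qed.

(** The boxes for which leb3_trace_le gives nothing: some tube of direction
null_dir a meets B in two points that are far apart along the tube. *)
Definition straddles (lambda eta r a : R) (B : set (R3 R)) : Prop :=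
  exists xi0 z z', [/\ tube_trace eta r (null_dir a) xi0 B z,
    tube_trace eta r (null_dir a) xi0 B z' & 2 * lambda < z.2 - z'.2].

(** By straddling, the doubled box contains differences s r n + O(delta) and s'
r n' + O(delta) with s, s' > 2 lambda. The bilinear form at these two vectors is
s s' r^2 times that at n, n' up to delta, and it is at most 12 A delta by
flatness. The conclusion follows from null_dir_bilinear; the factor 32 is 2 r^-2
/ 4, where s s' > 4 lambda^2. *)
Lemma straddles_uniq (lambda delta A a a' : R) c u (l : 'I_3 -> R) :
  0 < lambda -> 0 < delta -> delta <= 1 -> 0 < A -> 0 <= a <= 1 -> 0 <= a' <= 1 ->
  orthonormal3 u -> flat hyperbolic_form (A * delta) (box c u l) ->
  straddles lambda (delta / 8) 8^-1 a (box c u (fun i => 2 * l i)) ->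
  straddles lambda (delta / 8) 8^-1 a' (box c u (fun i => 2 * l i)) ->
  lambda ^+ 2 * (a - a') ^+ 2 <= 32 * (12 * A + 1) * delta.
Proof.
move=> l0 d0 d1 A0 a01 a01' ou fS [xi [z [w [[cz Bz] [cw Bw] zw]]]] [xi' [z' [w' [[cz' Bz'] [cw' Bw'] zw']]]].
have := flat_polarization ou fS Bz Bw Bz' Bw'.
have TB n x y : tube_map (delta / 8) 8^-1 n x - tube_map (delta / 8) 8^-1 n y =
    tube_map (delta / 8) 8^-1 n (x - y).
  by apply: R3P; rewrite /tube_map/= /GRing.scale/=; ring.
have KA (x y z0 : R3 R) : x + y - (x + z0) = y - z0 by rewrite opprD addrACA subrr add0r.
rewrite !KA !TB.
have cube_bd (x y : R3 R) : cube3 x -> cube3 y ->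
   [/\ `|(x - y).1.1| <= 2, `|(x - y).1.2| <= 2 & `|(x - y).2| <= 2].
  move=> [[x1 x2] x3] [[y1 y2] y3]; move: x1 x2 x3 y1 y2 y3; rewrite /= !in_itv/=.
  move=> /andP[? ?] /andP[? ?] /andP[? ?] /andP[? ?] /andP[? ?] /andP[? ?].
  have bd (s t : R) : -1 <= s -> s <= 1 -> -1 <= t -> t <= 1 -> `|s - t| <= 2.
    by clear; move=> *; rewrite ler_norml; apply/andP; split; lra.
  by split; exact: bd.
have := cube_bd _ _ cz cw; have := cube_bd _ _ cz' cw'.
have {}zw : 2 * lambda < (z - w).2 by [].
have {}zw' : 2 * lambda < (z' - w').2 by [].
move: (z - w) (z' - w') zw zw' => {Bz Bw Bz' Bw' cz cw cz' cw' z w z' w'}.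
move=> [[p q] s] [[p' q'] s'] /= sl sl' [].
rewrite !ler_norml => /andP[p1' p2'] /andP[q1' q2'] /andP[_ s2'] [].
move=> /andP[p1 p2] /andP[q1 q2] /andP[_ s2].
have := null_dir_bilinear a01 a01'.
rewrite /hyperbolic_bilinear /tube_map/= /GRing.scale/=.
have b01 (t : R) : 0 <= t <= 1 -> 0 <= Num.sqrt (1 - t ^+ 2) <= 1.
  move=> /andP[t0 t1]; rewrite sqrtr_ge0/= -[leRHS]sqrtr1 ler_wsqrtr//.
  by rewrite lerBlDl lerDr sqr_ge0.
have /andP[b0 b1] := b01 _ a01; have /andP[b0' b1'] := b01 _ a01'.
move: (Num.sqrt (1 - a ^+ 2)) (Num.sqrt (1 - a' ^+ 2)) b0 b1 b0' b1' => b b' b0 b1 b0' b1'.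
move/andP: a01 => [a0 a1]; move/andP: a01' => [a0' a1'].
set Bn := a * a' + b * b' - 1 * 1 => HB.
have -> : (delta / 8 * p + 8^-1 * s * a) * (delta / 8 * p' + 8^-1 * s' * a') +
  (delta / 8 * q + 8^-1 * s * b) * (delta / 8 * q' + 8^-1 * s' * b') -
  (0 + 8^-1 * s * 1) * (0 + 8^-1 * s' * 1) =
  delta / 64 * (delta * (p * p' + q * q') + s' * (p * a' + q * b') + s * (p' * a + q' * b))
  + (s * s') / 64 * Bn by rewrite /Bn; field.
move=> /andP[H _].
have c1 : p * p' + q * q' <= 8 by nra.
have c1' : delta * (p * p' + q * q') <= 8 by nra.
have c2 : - 4 <= p * a' + q * b' <= 4 by apply/andP; split; nra.
have c2' : s' * (p * a' + q * b') <= 8 by move/andP: c2 => [? ?]; nra.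
have c3 : - 4 <= p' * a + q' * b <= 4 by apply/andP; split; nra.
have c3' : s * (p' * a + q' * b) <= 8 by move/andP: c3 => [? ?]; nra.
have c4 : delta / 64 * (delta * (p * p' + q * q') + s' * (p * a' + q * b') + s * (p' * a + q' * b)) <= delta by nra.
have c5 : 4 * lambda ^+ 2 <= s * s' by nra.
have c6 : lambda ^+ 2 * (a - a') ^+ 2 * 2 <= s * s' * - Bn.
  have : 4 * lambda ^+ 2 * ((a - a') ^+ 2 / 2) <= s * s' * - Bn.
    apply: ler_pM => //; first by rewrite mulr_ge0// sqr_ge0.
    by rewrite divr_ge0 ?sqr_ge0.
  by lra.
by lra.
Qed.

(** A trace without two points far apart in the third parameter lies in a slab
of the cube. *)
Lemma leb3_trace_le (lambda eta r a : R) (xi0 : R3 R) (B : set mR3) : 0 < lambda ->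
  measurable B -> ~ straddles lambda eta r a B ->
  (leb3 (tube_trace eta r (null_dir a) xi0 B) <= (16 * lambda)%:E)%E.
Proof.
move=> l0 mB nst; have mT := measurable_tube_trace eta r (null_dir a) xi0 mB.
have [->|/set0P[z0 Tz0]] := eqVneq (tube_trace eta r (null_dir a) xi0 B) set0.
  by rewrite measure0 lee_fin mulr_ge0// ltW.
have mC : measurable (`[(-1)%R, 1%R]%classic `*` `[(-1)%R, 1%R]%classic `*`
    `[z0.2 - 2 * lambda, z0.2 + 2 * lambda]%classic : set mR3).
  by apply: measurableX => //; exact: measurableX.
apply: (@le_trans _ _ (leb3 (`[(-1)%R, 1%R]%classic `*` `[(-1)%R, 1%R]%classic `*`
    `[z0.2 - 2 * lambda, z0.2 + 2 * lambda]%classic : set mR3))).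
  apply: le_measure; rewrite ?inE// => z Tz; have [[[? ?] _] _] := Tz.
  split; [by split|rewrite /= in_itv/=].
  apply/andP; split; rewrite leNgt; apply/negP => H; apply: nst.
    by exists xi0, z0, z; split=> //; lra.
  by exists xi0, z, z0; split=> //; lra.
rewrite leb3_box// !lebesgue_measure_itv/= !lte_fin ifT; last by lra.
rewrite ifT; last by lra.
by rewrite -!EFinB -!EFinM lee_fin; lra.
Qed.

End Boxes.

(** * Sums over families of boxes *)

Section Esum.
Context {R : realType} {I : choiceType}.

(** For each n only finitely many terms are at least 1 / (n + 1). *)
Lemma esum_finite_countable (D : set I) (a : I -> \bar R) (M : R) :
  (forall i, D i -> (0 < a i)%E) -> (\esum_(i in D) a i <= M%:E)%E -> countable D.
Proof.
move=> a0 aM.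
pose Dn (n : nat) := D `&` [set i | ((n.+1%:R^-1)%:E <= a i)%E].
have -> : D = \bigcup_n Dn n.
  apply/seteqP; split=> [i Di|i [n _ []]//].
  have := a0 i Di; case E : (a i) => [r| |]//; rewrite ?lte_fin => r0.
    have [n nr] : exists n : nat, n.+1%:R^-1 <= r.
      exists (Num.truncn r^-1); rewrite invf_ple ?posrE//.
      by rewrite ltW// truncnS_gt.
    by exists n => //; split=> //=; rewrite E lee_fin.
  by exists 0%N => //; split=> //=; rewrite E leey.
apply: bigcup_countable => // n _; apply: finite_set_countable.
apply: contrapT => /(infinite_set_fset (Num.truncn (M * n.+1%:R)).+1) [B BD BN].
have : (\sum_(i \in [set` B]) a i <= M%:E)%E.
  apply: le_trans aM; apply: ereal_sup_ubound; exists [set` B] => //.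
  by split; [exact: finite_fset|move=> i /BD[]].
apply/negP; rewrite -ltNge.
apply: (@lt_le_trans _ _ (\sum_(i \in [set` B]) (n.+1%:R^-1)%:E)%E); last first.
  by apply: lee_fsum => // i /BD[].
rewrite fsbig_finite//= set_fsetK sumEFin lte_fin big_const_seq count_predT iter_addr_0.
rewrite -[ltRHS]mulr_natl ltr_pdivlMr//.
have [H|H] := leP 0 (M * n.+1%:R).
  by apply: (@lt_le_trans _ _ (Num.truncn (M * n.+1%:R)).+1%:R); rewrite ?truncnS_gt// ler_nat.
by apply: lt_le_trans H _; rewrite ler0n.
Qed.

Lemma esumMl_le (D : set I) (a : I -> \bar R) (k : R) : 0 <= k ->
  (forall i, (0 <= a i)%E) ->
  (\esum_(i in D) (k%:E * a i) <= k%:E * \esum_(i in D) a i)%E.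
Proof.
move=> k0 a0; apply: ge_ereal_sup => _ [X [finX XD] <-].
rewrite -ge0_mule_fsumr// lee_wpmul2l ?lee_fin//.
by apply: ereal_sup_ubound; exists X.
Qed.

End Esum.

Section IntegralEsum.
Context {R : realType} {I : pointedType} {d : measure_display} {T : measurableType d}.
Variable mu : {measure set T -> \bar R}.

(** Tonelli for a sum over a countable index set, reindexed by integers. *)
Lemma integral_esum (D : set I) (a : I -> T -> \bar R) : countable D ->
  (forall i x, D i -> (0 <= a i x)%E) -> (forall i, D i -> measurable_fun setT (a i)) ->
  (\int[mu]_x (\esum_(i in D) a i x) = \esum_(i in D) \int[mu]_x a i x)%E.
Proof.
move=> /countable_bijP[B]; rewrite card_eq_sym => /pcard_eqP/bijPex[g gB] a0 ma.
have gD i : B i -> D (g i) by case: gB => gB _ _; exact: gB.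
pose P (i : nat) : bool := `[<B i>].
have BE : B = [set x | P x] by apply/seteqP; split=> i /asboolP.
pose b i (x : T) : \bar R := if P i then a (g i) x else 0%E.
have b0 i x : (0 <= b i x)%E by rewrite /b; case: ifPn => // /asboolP /gD Di; exact: a0.
have E (c : I -> \bar R) : (forall i, D i -> (0 <= c i)%E) ->
    (\esum_(i in D) c i = \sum_(i <oo) (if P i then c (g i) else 0))%E.
  move=> c0; rewrite (reindex_esum B D g c gB) BE -nneseries_esum; last first.
    by move=> i /asboolP/gD; exact: c0.
  by rewrite eseries_mkcond.
rewrite E; last by move=> i Di; apply: integral_ge0 => x _; exact: a0.
transitivity (\int[mu]_x \sum_(i <oo) b i x)%E.
  by apply: eq_integral => x _; rewrite E// => i Di; exact: a0.
rewrite integral_nneseries//; last first.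
  move=> i; have [Pi|/negbTE Pi] := boolP (P i).
    have -> : b i = a (g i) by apply/funext => x; rewrite /b Pi.
    by apply: ma; apply: gD; apply/asboolP.
  have -> : b i = cst 0%E by apply/funext => x; rewrite /b Pi.
  exact: measurable_cst.
apply: eq_eseriesr => i _; rewrite /b; have [//|_] := boolP (P i).
by rewrite integral0.
Qed.

End IntegralEsum.

(** * Averaging over the base point of a tube *)

Section TraceAverage.
Context {R : realType}.
Local Notation mR := (measurableTypeR R).
Local Notation mR3 := (mR * mR * mR)%type.

Lemma measurable_trace_graph (eta r : R) n (B : set mR3) : measurable B ->
  measurable ([set w | tube_trace eta r n w.1 B w.2] : set (mR3 * mR3)).
Proof.
move=> mB.
have -> : [set w : mR3 * mR3 | tube_trace eta r n w.1 B w.2] =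
  (setT `*` cube3) `&` ((fun w : mR3 * mR3 => w.1 + tube_map eta r n w.2 : mR3) @^-1` B).
  by apply/seteqP; split=> -[x z]; [move=> [cz Bz]; split; [split|]|move=> [[_ ?] ?]; split].
apply: measurableI; first by apply: measurableX => //; exact: measurable_cube3.
have m : measurable_fun setT (fun w : mR3 * mR3 => w.1 + tube_map eta r n w.2 : mR3).
  apply: (measurableT_comp measurable_addr3 (g := fun w : mR3 * mR3 => (w.1, tube_map eta r n w.2))).
  apply: measurable_fun_pair => //.
  exact: (measurableT_comp (measurable_tube_map eta r n)).
by rewrite -[X in measurable X]setTI; exact: m.
Qed.

Lemma xsection_trace (eta r : R) n (B : set mR3) (x : mR3) :
  xsection ([set w | tube_trace eta r n w.1 B w.2] : set (mR3 * mR3)) x = tube_trace eta r n x B.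
Proof. by apply/seteqP; split=> z; rewrite /xsection/= inE. Qed.

Lemma measurable_leb3_trace (eta r : R) n (B : set mR3) : measurable B ->
  measurable_fun setT (fun x : mR3 => leb3 (tube_trace eta r n x B)).
Proof.
move=> mB.
have := @measurable_fun_xsection _ _ mR3 mR3 R sleb3 _ (measurable_trace_graph eta r n mB).
by congr measurable_fun; apply/funext => x /=; rewrite xsection_trace.
Qed.

(** Tonelli: for a fixed parameter z of the cube, the set of the base points xi0
for which the point of parameter z lies in B is a translate of B. *)
Lemma integral_leb3_trace (eta r : R) n (B : set mR3) : measurable B ->
  (\int[leb3]_x leb3 (tube_trace eta r n x B) = 8%:E * leb3 B)%E.
Proof.
move=> mB; have mG := measurable_trace_graph eta r n mB.
transitivity ((sleb3 \x sleb3)%E [set w : mR3 * mR3 | tube_trace eta r n w.1 B w.2]).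
  by apply: eq_integral => x _ /=; rewrite xsection_trace.
rewrite prod_measure_ysection//.
transitivity (\int[leb3]_z (leb3 B * (\1_cube3 z)%:E))%E.
  apply: eq_integral => z _; rewrite /= indicE.
  have -> : ysection [set w : mR3 * mR3 | tube_trace eta r n w.1 B w.2] z =
     if z \in cube3 then (fun x : mR3 => x + tube_map eta r n z : mR3) @^-1` B else set0.
    apply/seteqP; split=> x; rewrite /ysection/= inE/=.
      by move=> [cz Bz]; rewrite mem_set.
    by case: ifPn => //; rewrite inE => cz Bz; split.
  case: ifPn => zc; rewrite ?mule1 ?mule0 ?measure0//.
  have [_ _ H] := scales_leb3_translation (tube_map eta r n z).
  by rewrite [LHS]H// mul1e.
rewrite ge0_integralZl//; last first.
  by apply/measurable_EFinP; apply: measurable_indic; exact: measurable_cube3.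
rewrite integral_indic//; last exact: measurable_cube3.
by rewrite setIT leb3_cube3 muleC.
Qed.

End TraceAverage.

(** * The decoupling inequality tested on wave packets *)

Section Assembly.
Context {R : realType}.
Local Notation mR := (measurableTypeR R).
Local Notation mR3 := (mR * mR * mR)%type.

Lemma unit_cube3E : (unit_cube3 : set mR3) =
  `[0%R, 1%R]%classic `*` `[0%R, 1%R]%classic `*` `[0%R, 1%R]%classic.
Proof.
apply/seteqP; split=> x /=; rewrite /unit_cube3/= !in_itv/=; first by case.
by move=> [[]].
Qed.

Lemma measurable_unit_cube3 : measurable (unit_cube3 : set mR3).
Proof. by rewrite unit_cube3E; apply: measurableX => //; exact: measurableX. Qed.

Lemma leb3_unit_cube3 : leb3 (unit_cube3 : set mR3) = 1%E.
Proof.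
rewrite unit_cube3E leb3_box// lebesgue_measure_itv/= lte_fin ltr01.
by rewrite sube0 !mule1.
Qed.

(** Integrating the bound on the overlap over the unit cube. *)
Lemma esum_leb3_le (SS : set (set (R3 R))) (L : R) :
  (forall S, SS S -> measurable (S : set mR3) /\ S `<=` unit_cube3) ->
  (forall x : R3 R, (\esum_(S in SS) (\1_S x : R)%:E <= L%:E)%E) ->
  (\esum_(S in SS) leb3 (S : set mR3) <= L%:E)%E.
Proof.
move=> mSS H.
have L0 : 0 <= L.
  by rewrite -lee_fin; apply: le_trans (H 0); apply: esum_ge0 => S _; rewrite lee_fin.
apply: ge_ereal_sup => _ [X [finX XS] <-].
rewrite fsbig_finite//=.
have mX S : S \in fset_set X -> measurable (S : set mR3).
  by rewrite in_fset_set// inE => /XS/mSS[].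
(* Measurability of every term is built into g, so that the finite sum and the
   integral can be exchanged. *)
pose g S (x : mR3) : \bar R := if `[<measurable (S : set mR3)>] then (\1_S x)%:E else 0%E.
have g0 S x : (0 <= g S x)%E by rewrite /g; case: ifPn; rewrite ?lee_fin.
have mg S : measurable_fun setT (g S).
  rewrite /g; case: asboolP => [mS|_]; last exact: measurable_cst.
  by apply/measurable_EFinP; exact: measurable_indic.
have E : (\sum_(S <- fset_set X) leb3 (S : set mR3) = \int[leb3]_x \sum_(S <- fset_set X) g S x)%E.
  rewrite ge0_integral_sum// [LHS]big_seq [RHS]big_seq; apply: eq_bigr => S /mX mS.
  by rewrite /g asboolT// integral_indic// setIT.
rewrite [leLHS]E.
have <- : (\int[leb3]_x (L%:E * (\1_unit_cube3 x)%:E) = L%:E)%E.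
  rewrite ge0_integralZl//; last first.
    by apply/measurable_EFinP; apply: measurable_indic; exact: measurable_unit_cube3.
  rewrite integral_indic//; last exact: measurable_unit_cube3.
  by rewrite setIT leb3_unit_cube3 mule1.
apply: ge0_le_integralT => x; first by apply: sume_ge0.
rewrite indicE; have [xc|xc] := boolP (x \in unit_cube3).
  rewrite mule1; apply: le_trans (H x).
  apply: (@le_trans _ _ (\sum_(S \in X) (\1_S x : R)%:E)%E); last by apply: ereal_sup_ubound; exists X.
  rewrite fsbig_finite//=; apply: lee_sum => S _.
  by rewrite /g; case: ifPn => // _; rewrite lee_fin.
rewrite mule0 big_seq big1// => S; rewrite in_fset_set// inE => /XS/mSS[mS Sc].
rewrite /g asboolT// indicE; case: (boolP (x \in S)) => // xS.
by move: xc; rewrite mem_set//; apply: Sc; rewrite inE in xS.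
Qed.

Lemma powR_sqr (x r : R) : (x `^ r) ^+ 2 = x `^ (r * 2).
Proof. by rewrite powRrM powR_mulrn ?powR_ge0. Qed.

Lemma sqr_le_poweR_half (x C : R) (Y : \bar R) : 0 <= x -> 0 < C -> (0 <= Y)%E ->
  (x%:E <= C%:E * Y `^ (1 / 2))%E -> ((x ^+ 2)%:E <= (C ^+ 2)%:E * Y)%E.
Proof.
move=> x0 C0; case: Y => [y| |]// y0.
  rewrite poweR_EFin -!EFinM !lee_fin => H; move: y0; rewrite lee_fin => y0.
  have -> : C ^+ 2 * y = (C * y `^ (1 / 2)) ^+ 2.
    rewrite exprMn; congr (_ * _).
    by rewrite -powR_mulrn ?powR_ge0// -powRrM (_ : 1 / 2 * 2%:R = 1) ?powRr1//; field.
  by rewrite ler_sqr ?nnegrE// mulr_ge0 ?powR_ge0// ltW.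
by rewrite gt0_muley ?leey// lte_fin exprn_gt0.
Qed.

Lemma cLnorm_packet (eta r p : R) n xi0 : 0 < eta -> 0 < r -> 1 <= p ->
  cLnorm leb4 p (packet eta r n xi0) =
  ((packet_scale eta r * fejer_pmass p ^+ 4) `^ p^-1)%:E.
Proof.
move=> eta0 r0 p1; rewrite /cLnorm unlock -poweR_EFin; congr (_ `^ _)%E.
rewrite -(integral_packet_powR n xi0 eta0 r0 p1); apply: eq_integral => x _.
by rewrite gee0_abs ?lee_fin ?normc_ge0// poweR_EFin.
Qed.

(** The decoupling inequality tested on one packet. With p = 10/3, the square of
the norm of the packet is (K m)^(3/5), where K is packet_scale, and the square
of the norm of a box part is at most a constant times (2 M)^(7/5) K^(3/5),
because (p - 1) (2 / p) = 7/5. The powers of K cancel, which leaves a bound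
independent of the scale and of the tube. *)
Lemma packet_decoupling (Xi : set (R3 R) -> R3 R -> R[i]) (SS : set (set (R3 R)))
   (dbl : set (R3 R) -> set (R3 R)) (eta r c C : R) (n xi0 : R3 R) :
  0 < eta -> 0 < r -> n.2 = 1 -> 0 < c -> 0 < C ->
  (forall S, SS S -> [/\ measurable (dbl S : set mR3), cintegrable leb3 (Xi S),
     forall xi, fourier3 (Xi S) xi != 0 -> dbl S xi,
     forall xi, 0 <= fourier3 (Xi S) xi <= 1 &
     (cLnorm leb3 1 (Xi S) <= c%:E)%E]) ->
  let f := packet eta r n xi0 in
  (cLnorm leb4 (10 / 3) f <=
     C%:E * (\esum_(S in SS) cLnorm leb4 (10 / 3) (box_part Xi f S) ^+ 2) `^ (1 / 2))%E ->
  (((fejer_pmass (10 / 3) ^+ 4 / (2 * c * fejer_pmass 1 ^+ 4)) `^ (3 / 5) / C ^+ 2)%:E <=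
    \esum_(S in SS) ((2 * trace_mass eta r n xi0 (dbl S)) `^ (7 / 5))%:E)%E.
Proof.
move=> eta0 r0 n2 c0 C0 hS f; have p1 : 1 <= 10 / 3 :> R by lra.
rewrite /f cLnorm_packet//.
have K0 := packet_scale_gt0 eta0 r0.
have m10 : 0 < fejer_pmass 1 :> R by exact: fejer_pmass_gt0.
have mp0 : 0 < fejer_pmass (10 / 3) :> R by exact: fejer_pmass_gt0.
move=> /sqr_le_poweR_half => /(_ (powR_ge0 _ _) C0) H.
have {}H := H (esum_ge0 (fun S _ => sqre_ge0 _)).
set b := 2 * c * fejer_pmass 1 ^+ 4.
have b0 : 0 < b.
  by apply: mulr_gt0; [apply: mulr_gt0|apply: exprn_gt0].
have Kb0 : 0 < (packet_scale eta r * b) `^ (3 / 5) by apply: powR_gt0; exact: mulr_gt0.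
have bound S : SS S -> (cLnorm leb4 (10 / 3) (box_part Xi f S) ^+ 2 <=
   ((packet_scale eta r * b) `^ (3 / 5))%:E *
   ((2 * trace_mass eta r n xi0 (dbl S)) `^ (7 / 5))%:E)%E.
  move=> /hS[mB XiI XiB Xi01 Xic].
  have := box_part_Lp xi0 eta0 r0 n2 mB XiI XiB Xi01 (ltW c0) Xic p1.
  have M0 : 0 <= trace_mass eta r n xi0 (dbl S) by exact: fine_ge0.
  move: (trace_mass _ _ _ _ _) M0 => M M0 HL.
  have L0 : (0 <= cLnorm leb4 (10 / 3) (box_part Xi f S))%E by exact: Lnorm_ge0.
  apply: (@le_trans _ _ ((((2 * M) `^ (10 / 3 - 1) * (2 * c * (packet_scale eta r * fejer_pmass 1 ^+ 4))) `^ (10 / 3)^-1)%:E ^+ 2)%E).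
    by rewrite !expe2 lee_pmul.
  rewrite -EFin_expe -EFinM lee_fin powR_sqr.
  rewrite (_ : (10 / 3)^-1 * 2 = 3 / 5); last by field.
  rewrite (_ : 2 * c * _ = packet_scale eta r * b); last by rewrite /b; ring.
  rewrite powRM ?powR_ge0 ?(ltW (mulr_gt0 _ _))// -powRrM.
  by rewrite (_ : (10 / 3 - 1) * (3 / 5) = 7 / 5) 1?mulrC//; field.
have C20 : 0 < C ^+ 2 by exact: exprn_gt0.
have Y0 S : (0 <= ((2 * trace_mass eta r n xi0 (dbl S)) `^ (7 / 5))%:E)%E.
  by rewrite lee_fin powR_ge0.
have := le_trans (le_esum bound) (esumMl_le SS (ltW Kb0) Y0).
move: (esum _ _) (esum _ _) H => Y Z H YZ.
have {H YZ} : (((packet_scale eta r * fejer_pmass (10 / 3) ^+ 4) `^ (10 / 3)^-1 ^+ 2)%:E <=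
    (C ^+ 2 * (packet_scale eta r * b) `^ (3 / 5))%:E * Y)%E.
  rewrite [X in (_ <= X * _)%E]EFinM -muleA; apply: le_trans H _.
  by apply: lee_wpmul2l YZ; rewrite lee_fin ltW.
rewrite -lee_pdivrMl; last exact: mulr_gt0.
rewrite -EFinM; congr (_%:E <= _)%E.
have mp4 : 0 < fejer_pmass (10 / 3) ^+ 4 :> R by exact: exprn_gt0.
clearbody b.
move: (packet_scale eta r) (fejer_pmass (10 / 3) ^+ 4) K0 mp4 Kb0 C20 {bound} => K a K0 a0 Kb0 C20.
rewrite powR_sqr (_ : (10 / 3)^-1 * 2 = 3 / 5); last by field.
move: Kb0; rewrite !powRM ?invr_ge0 ?(ltW K0) ?(ltW a0) ?(ltW b0)//.
have -> : (b^-1) `^ (3 / 5) = (b `^ (3 / 5))^-1.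
  by rewrite -powR_inv1 ?(ltW b0)// -powRrM mulrC powRrM powR_inv1 ?powR_ge0.
have Kp : 0 < K `^ (3 / 5) by exact: powR_gt0.
have bp : 0 < b `^ (3 / 5) by exact: powR_gt0.
move: (K `^ _) (b `^ _) (a `^ _) Kp bp => k b' a' k0 b'0 _.
by field; rewrite !lt0r_neq0.
Qed.

(** A bound for the factor (2 M)^(2/5), where M is the measure of a trace: M is
at most 8 in all cases, and at most 16 lambda when the box does not straddle. *)
Definition box_weight (lambda eta r a : R) (B : set (R3 R)) : R :=
  if `[<straddles lambda eta r a B>] then 16 else (32 * lambda) `^ (2 / 5).

Lemma box_weight_ge0 lambda eta r a B : 0 <= box_weight lambda eta r a B.
Proof. by rewrite /box_weight; case: ifP => // _; exact: powR_ge0. Qed.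

(** The exponent 7/5 is larger than 1: the excess 2/5 is the gain from short
traces. *)
Lemma trace_mass_powR_le (lambda eta r a : R) (xi0 : R3 R) (B : set mR3) :
  0 < lambda -> measurable B ->
  (2 * trace_mass eta r (null_dir a) xi0 B) `^ (7 / 5) <=
  2 * box_weight lambda eta r a B * trace_mass eta r (null_dir a) xi0 B.
Proof.
move=> l0 mB; have T0 : 0 <= trace_mass eta r (null_dir a) xi0 B by exact: fine_ge0.
have T8 : trace_mass eta r (null_dir a) xi0 B <= 8.
  by rewrite -lee_fin -leb3_tube_traceE//; exact: leb3_tube_trace_le8.
have Tl : ~ straddles lambda eta r a B -> trace_mass eta r (null_dir a) xi0 B <= 16 * lambda.
  by move=> nst; rewrite -lee_fin -leb3_tube_traceE//; exact: leb3_trace_le.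
rewrite /box_weight; move: (trace_mass _ _ _ _ _) T0 T8 Tl => t t0 t8 tl.
have t20 : 0 <= 2 * t by rewrite mulr_ge0.
rewrite -[leLHS]mulr_powRB1//.
rewrite (_ : 7 / 5 - 1 = 2 / 5); last by field.
rewrite [leRHS]mulrAC ler_wpM2l//; case: asboolP => [_|/tl {}tl].
  apply: (@le_trans _ _ (16 `^ (2 / 5))); last by apply: ler1_powR; lra.
  by apply: ge0_ler_powR; rewrite ?nnegrE//; lra.
by apply: ge0_ler_powR; rewrite ?nnegrE//; lra.
Qed.

Lemma leb3_middle_cube :
  leb3 (`[4^-1%R, (3 / 4)%R]%classic `*` `[4^-1%R, (3 / 4)%R]%classic `*` `[4^-1%R, (3 / 4)%R]%classic : set mR3) = 8^-1%:E.
Proof.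
rewrite leb3_box// lebesgue_measure_itv/= lte_fin ifT; last by lra.
by rewrite -EFinB -!EFinM; congr EFin; field.
Qed.

(** The lower bound of packet_decoupling, integrated over the middle cube of
volume 1/8. The right side is integrated over all base points with
integral_leb3_trace, which turns the measures of the traces into the volume of
the box. *)
Lemma average_over_tubes (SS : set (set (R3 R))) (dbl : set (R3 R) -> set (R3 R)) (lambda eta r a kappa : R) :
  0 < lambda -> countable SS ->
  (forall S, SS S -> measurable (dbl S : set mR3)) ->
  (forall xi0 : R3 R, [/\ 4^-1 <= xi0.1.1 <= 3 / 4, 4^-1 <= xi0.1.2 <= 3 / 4 & 4^-1 <= xi0.2 <= 3 / 4] ->
    (kappa%:E <= \esum_(S in SS) ((2 * trace_mass eta r (null_dir a) xi0 (dbl S)) `^ (7 / 5))%:E)%E) ->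
  0 <= kappa ->
  ((kappa / 8)%:E <= \esum_(S in SS) ((16 * box_weight lambda eta r a (dbl S))%:E * leb3 (dbl S : set mR3)))%E.
Proof.
move=> l0 cSS mSS H k0.
set Q := (`[4^-1%R, (3 / 4)%R]%classic `*` `[4^-1%R, (3 / 4)%R]%classic `*` `[4^-1%R, (3 / 4)%R]%classic : set mR3).
have mQ : measurable Q by apply: measurableX => //; exact: measurableX.
have <- : (\int[leb3]_x (kappa%:E * (\1_Q x)%:E) = (kappa / 8)%:E)%E.
  rewrite ge0_integralZl//; last by apply/measurable_EFinP; exact: measurable_indic.
  by rewrite integral_indic// setIT leb3_middle_cube.
pose F S (x : mR3) : \bar R := ((2 * box_weight lambda eta r a (dbl S))%:E *
  leb3 (tube_trace eta r (null_dir a) x (dbl S) : set mR3))%E.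
have w0 S : 0 <= 2 * box_weight lambda eta r a (dbl S) by rewrite mulr_ge0// box_weight_ge0.
have F0 S x : (0 <= F S x)%E by rewrite /F mule_ge0 ?lee_fin.
apply: (@le_trans _ _ (\int[leb3]_x (\esum_(S in SS) F S x))%E).
  apply: ge0_le_integralT => x; first by rewrite mule_ge0 ?lee_fin.
  rewrite indicE; have [|xQ] := boolP (x \in Q); last by rewrite mule0; exact: esum_ge0.
  rewrite inE mule1 => -[[/= h1 h2] h3]; rewrite !in_itv/= in h1 h2 h3.
  apply: le_trans (H x _) _; first by split.
  apply: le_esum => S /mSS mS; rewrite /F leb3_tube_traceE// -EFinM lee_fin.
  exact: trace_mass_powR_le.
rewrite leb3E (integral_esum sleb3 cSS (a := F))//; last first.
  by move=> S /mSS mS; apply: measurable_funeM; exact: measurable_leb3_trace.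
apply: le_esum => S /mSS mS; rewrite /F -leb3E ge0_integralZl_EFin//; last first.
  exact: measurable_leb3_trace.
rewrite integral_leb3_trace// muleA -EFinM lee_wpmul2r// lee_fin; lra.
Qed.

End Assembly.

(** * Contradiction at a suitable scale *)

Section Main.
Context {R : realType}.
Local Notation mR := (measurableTypeR R).
Local Notation mR3 := (mR * mR * mR)%type.

Lemma sum_one_exception (N : nat) (P : 'I_N -> Prop) (b w : R) : 0 <= w -> 0 <= b ->
  (forall i j, P i -> P j -> i = j) ->
  \sum_(i < N) (if `[<P i>] then b else w) <= b + N%:R * w.
Proof.
move=> w0 b0 uniqP; have [[i Pi]|nP] := pselect (exists i, P i); last first.
  rewrite (eq_bigr (fun=> w)); last by move=> i _; rewrite asboolF// => Pi; apply: nP; exists i.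
  by rewrite sumr_const card_ord mulr_natl lerDr.
rewrite (bigD1 i)//= asboolT// lerD2l.
apply: (@le_trans _ _ (\sum_(j < N) w)); last by rewrite sumr_const card_ord mulr_natl.
rewrite [leRHS](bigD1 i)//= -[leLHS]add0r lerD//.
apply: ler_sum => j ji; case: asboolP => // Pj.
by rewrite (uniqP _ _ Pi Pj) eqxx in ji.
Qed.

Lemma sqr_natrB_ge1 (i j : nat) : i != j -> 1 <= (i%:R - j%:R) ^+ 2 :> R.
Proof.
by case: ltngtP => // ij _; move: ij; rewrite -(@ler_nat R) -natr1 => ij; nra.
Qed.

(** The double of a set is defined through a presentation of it as a box, so one
presentation is chosen for each member of the family. *)
Lemma choose_doubles (SS : set (set (R3 R))) :
  (forall S, SS S -> rectangular_box S) ->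
  exists dbl : set (R3 R) -> set (R3 R), forall S, SS S ->
    exists c u (l : 'I_3 -> R), [/\ orthonormal3 u, forall i, 0 < l i, S = box c u l &
      dbl S = box c u (fun i => 2 * l i)].
Proof.
move=> H; have /choice[dbl hdbl] : forall S, exists D : set (R3 R), SS S ->
    exists c u (l : 'I_3 -> R), [/\ orthonormal3 u, forall i, 0 < l i, S = box c u l &
      D = box c u (fun i => 2 * l i)].
  move=> S; have [SSS|] := pselect (SS S); last by exists set0.
  have [c [u [l [ou l0 SE]]]] := H _ SSS.
  by exists (box c u (fun i => 2 * l i)) => _; exists c, u, l.
by exists dbl.
Qed.

(** The sum of average_over_tubes over the directions k / N: each box has weight
16 for at most one of them, because two distinct directions are at least 1 / N
apart and the assumed smallness of delta is incompatible with straddles_uniq.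
The constant 128 is 16 times the factor 8 between the volumes of a box and of
its double. *)
Lemma fixed_scale (Xi : set (R3 R) -> R3 R -> R[i]) (SS : set (set (R3 R)))
  (c C L A lambda delta : R) (N : nat) :
  0 < c -> 0 < C -> 0 < A -> 0 < lambda -> 0 < delta -> delta <= 1 / 2 ->
  (forall c0 u (l : 'I_3 -> R), orthonormal3 u -> (forall i, 0 < l i) ->
    [/\ cintegrable leb3 (Xi (box c0 u l)),
     forall xi, fourier3 (Xi (box c0 u l)) xi != 0 -> box c0 u (fun i => 2 * l i) xi,
     forall xi, 0 <= fourier3 (Xi (box c0 u l)) xi <= 1 &
     (cLnorm leb3 1 (Xi (box c0 u l)) <= c%:E)%E]) ->
  32 * (12 * A + 1) * delta < lambda ^+ 2 * (N%:R^-1) ^+ 2 ->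
  (forall S, SS S -> rectangular_box S /\ S `<=` unit_cube3) ->
  (forall x : R3 R, (\esum_(S in SS) (\1_S x : R)%:E <= L%:E)%E) ->
  (forall S, SS S -> flat hyperbolic_form (A * delta) S) ->
  (forall f : R4 R -> R[i], cintegrable leb4 f ->
     fun_support (fourier4 f) `<=` neighborhood delta (graph_surface hyperbolic_form) ->
     (cLnorm leb4 (10 / 3) f <=
       C%:E * (\esum_(S in SS) cLnorm leb4 (10 / 3) (box_part Xi f S) ^+ 2) `^ (1 / 2))%E) ->
  N%:R * ((fejer_pmass (10 / 3) ^+ 4 / (2 * c * fejer_pmass 1 ^+ 4)) `^ (3 / 5) / C ^+ 2 / 8)
   <= 128 * (16 + N%:R * (32 * lambda) `^ (2 / 5)) * L.
Proof.
move=> c0 C0 A0 l0 d0 d1; have d2 : delta <= 1 by lra.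
move=> hXi hN hSS hL hflat hdec.
have [dbl hdbl] := choose_doubles (fun S SSS => (hSS S SSS).1).
have mS S : SS S -> measurable (S : set mR3).
  by move=> /hdbl[c' [u [l [ou _ -> _]]]]; exact: measurable_box.
have mdbl S : SS S -> measurable (dbl S : set mR3).
  by move=> /hdbl[c' [u [l [ou _ _ ->]]]]; exact: measurable_box.
have leb_dbl S : SS S -> leb3 (dbl S : set mR3) = (8%:E * leb3 (S : set mR3))%E.
  by move=> /hdbl[c' [u [l [ou _ -> ->]]]]; exact: leb3_box_double.
have sumS : (\esum_(S in SS) leb3 (S : set mR3) <= L%:E)%E.
  by apply: esum_leb3_le => // S SSS; split; [exact: mS|exact: (hSS S SSS).2].
have cSS : countable SS.
  apply: esum_finite_countable sumS => S /hdbl[c' [u [l [ou l1 -> _]]]].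
  exact: leb3_box_gt0.
set kappa := (_ `^ (3 / 5) / C ^+ 2).
have kappa0 : 0 <= kappa by rewrite divr_ge0 ?powR_ge0// exprn_ge0// ltW.
pose dir (k : 'I_N) : R := k%:R / N%:R.
have N0 (k : 'I_N) : 0 < N%:R :> R by rewrite ltr0n (leq_ltn_trans _ (ltn_ord k)).
have dir01 k : 0 <= dir k <= 1.
  by rewrite /dir divr_ge0//= ler_pdivrMr ?(N0 k)// mul1r ler_nat ltnW.
have avg k : ((kappa / 8)%:E <= \esum_(S in SS)
    ((16 * box_weight lambda (delta / 8) 8^-1 (dir k) (dbl S))%:E * leb3 (dbl S : set mR3)))%E.
  apply: average_over_tubes => // xi0 hxi0.
  have e0 : 0 < delta / 8 by rewrite divr_gt0.
  apply: (packet_decoupling (Xi := Xi)) => //.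
    move=> S SSS; have [c' [u [l [ou l1 SE DE]]]] := hdbl S SSS.
    have [h1 h2 h3 h4] := hXi c' u l ou l1.
    by split; rewrite ?DE ?SE//; exact: measurable_box.
  apply: hdec; first exact: cintegrable_packet.
  apply: (@subset_trans _ (packet_region (delta / 8) 8^-1 (null_dir (dir k)) xi0)).
    exact: fun_support_packet.
  exact: packet_region_sub.
have W0 S k : 0 <= box_weight lambda (delta / 8) 8^-1 (dir k) (dbl S) by exact: box_weight_ge0.
have sumW S : SS S -> \sum_(k < N) box_weight lambda (delta / 8) 8^-1 (dir k) (dbl S) <=
    16 + N%:R * (32 * lambda) `^ (2 / 5).
  move=> SSS; have [c' [u [l [ou l1 SE DE]]]] := hdbl S SSS.
  apply: sum_one_exception => //; first exact: powR_ge0.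
  move=> i j; rewrite DE => si sj; apply/eqP/negPn/negP => ij.
  have fS : flat hyperbolic_form (A * delta) (box c' u l) by rewrite -SE; exact: hflat.
  have := straddles_uniq l0 d0 d2 A0 (dir01 i) (dir01 j) ou fS si sj.
  apply/negP; rewrite -ltNge; apply: lt_le_trans hN _.
  rewrite ler_pM2l ?exprn_gt0// /dir -mulrBl exprMn ler_peMl ?sqr_ge0//.
  exact: sqr_natrB_ge1.
rewrite -lee_fin EFinM.
apply: (@le_trans _ _ (\sum_(k < N) \esum_(S in SS)
    ((16 * box_weight lambda (delta / 8) 8^-1 (dir k) (dbl S))%:E * leb3 (dbl S : set mR3)))%E).
  apply: (@le_trans _ _ (\sum_(k < N) (kappa / 8)%:E)%E); last by apply: lee_sum => k _; exact: avg.
  by rewrite sumEFin sumr_const card_ord -EFinM mulr_natl.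
rewrite -esum_sum; last by move=> S k _ _; rewrite mule_ge0 ?lee_fin ?mulr_ge0.
rewrite EFinM; apply: le_trans (lee_wpmul2l _ sumS); last first.
  by rewrite lee_fin mulr_ge0// addr_ge0// mulr_ge0// powR_ge0.
apply: le_trans (esumMl_le _ _ _) => //; last first.
  by rewrite mulr_ge0// addr_ge0// mulr_ge0// powR_ge0.
apply: le_esum => S SSS.
rewrite -ge0_sume_distrl; last by move=> k _; rewrite lee_fin mulr_ge0.
rewrite leb_dbl// muleA lee_wpmul2r// sumEFin -EFinM lee_fin -mulr_sumr.
move: (\sum_(k < N) _) (16 + _) (sumW S SSS) => w y wy.
by rewrite mulrAC (_ : 128 = 16 * 8); [rewrite ler_wpM2l|ring].
Qed.

(** With N = M^3, lambda = M^-10 and delta = M^-30, the term N lambda^(2/5) is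
of order 1 / M, the factor delta^(-2 eps) = M^(60 eps) is at most M, and log (1
/ delta) is at most 30 M. So the left side is O(M) and the right side is at
least of order M^2. The spacing condition reads 32 (12 A + 1) < M^4. *)
Lemma exists_bad_scale (k0 C A eps : R) : 0 < k0 -> 0 < C -> 0 < A -> 0 < eps -> eps < 60^-1 ->
  exists delta lambda (N : nat), [/\ 0 < delta, delta <= 1 / 2, 0 < lambda,
    32 * (12 * A + 1) * delta < lambda ^+ 2 * (N%:R^-1) ^+ 2 &
    128 * (16 + N%:R * (32 * lambda) `^ (2 / 5)) * (C * ln delta^-1) <
    N%:R * (k0 / (C * delta `^ (- eps)) ^+ 2 / 8)].
Proof.
move=> k00 C0 A0 eps0 eps1.
pose B := 128 * 20 * (C * 30).
have B0 : 0 < B by rewrite /B !mulr_gt0.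
have T0 : 0 < 8 * B * C ^+ 2 / k0 by rewrite divr_gt0 ?mulr_gt0 ?exprn_gt0.
have [m hm] : exists m : nat, 2 + 32 * (12 * A + 1) + 8 * B * C ^+ 2 / k0 < m%:R.
  exists (Num.bound (2 + 32 * (12 * A + 1) + 8 * B * C ^+ 2 / k0)).
  by rewrite archi_boundP//; lra.
set M : R := m%:R in hm.
have M2 : 2 < M by lra.
have MA : 32 * (12 * A + 1) < M by lra.
have MB : 8 * B * C ^+ 2 / k0 < M by lra.
have M0 : 0 < M by lra.
have M1 : 1 <= M by lra.
have Mn n : M ^+ n = M `^ n%:R by rewrite powR_mulrn// ltW.
exists (M ^- 30), (M ^- 10), (m ^ 3)%N; rewrite natrX -/M; split.
- by rewrite invr_gt0 exprn_gt0.
- rewrite div1r lef_pV2 ?posrE ?exprn_gt0//; apply: (le_trans (ltW M2)).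
  by rewrite -[leLHS]expr1 ler_weXn2l.
- by rewrite invr_gt0 exprn_gt0.
- rewrite (_ : (M ^- 10) ^+ 2 * (M ^+ 3)^-1 ^+ 2 = M ^+ 4 * M ^- 30); last first.
    by field; exact: lt0r_neq0.
  rewrite ltr_pM2r ?invr_gt0 ?exprn_gt0//; apply: (lt_le_trans MA).
  by rewrite -[leLHS]expr1 ler_weXn2l.
have -> : (32 * M ^- 10) `^ (2 / 5) = (2 / M ^+ 2) ^+ 2.
  rewrite (_ : 32 * M ^- 10 = (2 / M ^+ 2) ^+ 5); last by field; exact: lt0r_neq0.
  have h : 0 <= 2 / M ^+ 2 by rewrite divr_ge0// exprn_ge0// ltW.
  move: (2 / M ^+ 2) h => y h; rewrite -[y ^+ 5]powR_mulrn// -powRrM.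
  by rewrite -[RHS]powR_mulrn//; congr (_ `^ _); field.
set D := _ `^ (- eps).
have D0 : 0 < D by rewrite powR_gt0// invr_gt0 exprn_gt0.
have DM : D ^+ 2 <= M.
  rewrite /D powR_sqr -powR_inv1 ?exprn_ge0 ?(ltW M0)// Mn -!powRrM.
  rewrite -[leRHS]powRr1 ?(ltW M0)// ler_powR//; lra.
have lnM : ln (M ^- 30)^-1 <= 30 * M.
  rewrite invrK lnXn// -[leLHS]mulr_natl ler_wpM2l//.
  by have := ln_sublinear M0; exact: ltW.
have l0 : 0 <= ln (M ^- 30)^-1 by rewrite invrK ln_ge0// exprn_ege1.
have S20 : 16 + M ^+ 3 * (2 / M ^+ 2) ^+ 2 <= 20.
  rewrite (_ : M ^+ 3 * _ = 4 / M); last by field; exact: lt0r_neq0.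
  suff : 4 / M <= 4 by lra.
  by rewrite ler_pdivrMr// ler_peMr.
apply: (@le_lt_trans _ _ (B * M)).
  rewrite (_ : B * M = 128 * 20 * (C * (30 * M))); last by rewrite /B; ring.
  apply: ler_pM.
  - by rewrite mulr_ge0// addr_ge0// mulr_ge0 ?exprn_ge0 ?(ltW M0)// divr_ge0// exprn_ge0// ltW.
  - by rewrite mulr_ge0// ltW.
  - by rewrite ler_pM2l.
  - by rewrite ler_pM2l.
apply: (@lt_le_trans _ _ (M ^+ 3 * (k0 / (C ^+ 2 * M) / 8))).
  rewrite (_ : M ^+ 3 * _ = k0 * M / (8 * C ^+ 2) * M); last first.
    by field; rewrite !lt0r_neq0.
  rewrite ltr_pM2r// ltr_pdivlMr ?mulr_gt0 ?exprn_gt0//.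
  by move: MB; rewrite ltr_pdivrMr// => MB; rewrite mulrA (mulrC B) [ltRHS]mulrC.
rewrite ler_pM2l ?exprn_gt0// ler_pM2r// ler_pM2l// exprMn.
by rewrite lef_pV2 ?posrE ?mulr_gt0 ?exprn_gt0// ler_pM2l ?exprn_gt0.
Qed.

End Main.

Theorem theorem6p1 (R : realType) (Xi : set (R3 R) -> R3 R -> R[i])
    (hXi : box_multiplier_family Xi) (eps A : R)
    (eps_gt0 : 0 < eps) (eps_lt : eps < 1 / 1000) (A_gt0 : 0 < A) :
  ~ exists C : R, forall delta : R, 0 < delta -> delta <= 1 / 2 ->
      exists SS : set (set (R3 R)),
        [/\ forall S, SS S -> rectangular_box S /\ S `<=` unit_cube3,
            forall x : R3 R,
              (\esum_(S in SS) (\1_S x : R)%:E <= (C * ln (delta^-1))%:E)%E,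
            forall S, SS S -> flat hyperbolic_form (A * delta) S &
            forall f : R4 R -> R[i], cintegrable leb4 f ->
              fun_support (fourier4 f)
                `<=` neighborhood delta (graph_surface hyperbolic_form) ->
              (cLnorm leb4 (10 / 3) f <=
                 (C * delta `^ (- eps))%:E *
                 (\esum_(S in SS) cLnorm leb4 (10 / 3) (box_part Xi f S) ^+ 2)
                   `^ (1 / 2))%E].

Proof.
case=> C1 H; pose C := Num.max C1 1.
have C0 : 0 < C by rewrite /C lt_max ltr01 orbT.
have C1C : C1 <= C by rewrite /C le_max lexx.
have [c c0 cE] : exists2 c : R, 0 < c & c = 1000 by exists 1000; rewrite ?ltr0n.
have k0 : 0 < (fejer_pmass (10 / 3) ^+ 4 / (2 * c * fejer_pmass 1 ^+ 4)) `^ (3 / 5) :> R.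
  have p1 : 1 <= 10 / 3 :> R by lra.
  have m1 : 0 < fejer_pmass 1 :> R by exact: fejer_pmass_gt0.
  have m2 : 0 < fejer_pmass (10 / 3) :> R by exact: fejer_pmass_gt0.
  by rewrite powR_gt0// divr_gt0 ?exprn_gt0// mulr_gt0 ?exprn_gt0// mulr_gt0.
have eps60 : eps < 60^-1.
  by apply: lt_trans eps_lt _; rewrite div1r ltf_pV2 ?posrE ?ltr0n// ltr_nat.
have hXi' (c1 : R3 R) u (l : 'I_3 -> R) : orthonormal3 u -> (forall i, 0 < l i) ->
    [/\ cintegrable leb3 (Xi (box c1 u l)),
     forall xi, fourier3 (Xi (box c1 u l)) xi != 0 -> box c1 u (fun i => 2 * l i) xi,
     forall xi, 0 <= fourier3 (Xi (box c1 u l)) xi <= 1 &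
     (cLnorm leb3 1 (Xi (box c1 u l)) <= c%:E)%E].
  rewrite cE => ou l0; have [_ [sX X01 _ [iX nX]]] := hXi c1 u l ou l0.
  by split=> // xi xi0; apply: sX; exact: subset_closure.
clear hXi cE eps_lt.
have [delta [lambda [N [d0 d1 l0 hN]]]] := exists_bad_scale k0 C0 A_gt0 eps_gt0 eps60.
have [SS [hSS hL hflat hdec]] := H delta d0 d1.
have ln0 : 0 <= ln delta^-1.
  rewrite ln_ge0// invf_ge1//; apply: le_trans d1 _.
  by rewrite div1r invf_cp1 ?ler1n.
have D0 : 0 < delta `^ (- eps) by exact: powR_gt0.
apply/negP; rewrite -leNgt.
apply: (fixed_scale (Xi := Xi) (SS := SS) (A := A) (delta := delta)) => //.
- exact: mulr_gt0.
- by move=> x; apply: le_trans (hL x) _; rewrite lee_fin ler_wpM2r.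
- move=> f fI fS; apply: le_trans (hdec f fI fS) _.
  by apply: lee_wpmul2r; [exact: poweR_ge0|rewrite lee_fin ler_wpM2r// ltW].
Qed.
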